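(* Let $(X_n)_{n\in\mathbb{Z}_+}$ be an inhomogeneous INAR(1) process with offspring means $\varrho_n=\mathsf{E}\xi_{n,1}$ and immigration variables $\varepsilon_n$, and let $m_{n,j}=\mathsf{E}\varepsilon_n(\varepsilon_n-1)\cdots(\varepsilon_n-j+1)$ for $n,j\in\mathbb{N}$. Let $J\in\mathbb{N}$. Assume that (i) $\varrho_n<1$ for all $n\in\mathbb{N}$, $\lim_{n\to\infty}\varrho_n=1$, and $\sum_{n=1}^\infty(1-\varrho_n)=\infty$; (ii) $\lim_{n\to\infty}\frac{m_{n,j}}{j(1-\varrho_n)}=\lambda_j\in[0,\infty)$ for $j=1,\dots,J$, with $\lambda_J=0$. Then $X_n$ converges in distribution to $\mathrm{CP}(\mu)$ as $n\to\infty$, where $\mu$ is a finite measure on $\{1,\dots,J-1\}$ given by $$\mu\{j\}:=\frac{1}{j!}\sum_{i=0}^{J-j-1}\frac{(-1)^i}{i!}\lambda_{j+i},\qquad j=1,\dots,J-1.$$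
   Context: An inhomogeneous INAR(1) process $(X_n)_{n\in\mathbb{Z}_+}$ is defined by $X_0=0$ and $X_n=\sum_{j=1}^{X_{n-1}}\xi_{n,j}+\varepsilon_n$ for $n\in\mathbb{N}$, where $\{\xi_{n,j},\varepsilon_n:n,j\in\mathbb{N}\}$ are independent non-negative integer-valued random variables such that, for each $n\in\mathbb{N}$, the variables $\{\xi_{n,j}:j\in\mathbb{N}\}$ are identically distributed and $\mathsf{P}(\xi_{n,1}\in\{0,1\})=1$. The offspring means are $\varrho_n:=\mathsf{E}\xi_{n,1}\in[0,1]$. For a finite measure $\mu$ on $\mathbb{Z}_+$ (a measure on a subset of $\mathbb{Z}_+$ being extended by $0$), the compound Poisson distribution $\mathrm{CP}(\mu)$ with intensity measure $\mu$ is the probability measure on $\mathbb{Z}_+$ with generating function $z\mapsto\exp\{\sum_{j=1}^\infty\mu\{j\}(z^j-1)\}$ for $z\in\mathbb{C}$, $|z|\le 1$. *)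

(* Defs.v *)
From mathcomp Require Import all_boot all_order all_algebra finmap complex.
From mathcomp Require Import all_classical all_reals all_analysis.

Set Implicit Arguments.
Unset Strict Implicit.
Unset Printing Implicit Defensive.

Import Order.TTheory GRing.Theory Num.Theory.
Import numFieldNormedType.Exports.

Local Open Scope classical_set_scope.
Local Open Scope complex_scope.
Local Open Scope ring_scope.

Definition mutually_independent (d d' : measure_display) (T : measurableType d)
    (T' : measurableType d') (R : realType) (P : probability T R)
    (I : choiceType) (D : set I) (Y : I -> {RV P >-> T'}) : Prop :=
  forall (s : {fset I}) (A : I -> set T'),
    [set` s] `<=` D ->
    (forall i, i \in s -> measurable (A i)) ->
    P (\bigcap_(i in [set` s]) (Y i @^-1` A i)) =
    (\prod_(i <- s) P (Y i @^-1` A i))%E.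

Section INAR.
Context (d : measure_display) (T : measurableType d)
  (R : realType) (P : probability T R).

(* All the random variables xi_{n,j} and eps_n as a single family. *)
Definition innovations (xi : nat -> nat -> {RV P >-> nat})
    (eps : nat -> {RV P >-> nat}) (i : (nat * nat) + nat) : {RV P >-> nat} :=
  match i with
  | inl nj => xi nj.1 nj.2
  | inr n => eps n
  end.

(* The indices n and j of xi n j and eps n start from 1: xi 0 j, xi n 0 and
   eps 0 are junk values, which are left unconstrained. *)
Definition innovation_index : set ((nat * nat) + nat) :=
  [set i | match i with
           | inl nj => (1 <= nj.1)%N && (1 <= nj.2)%N
           | inr n => (1 <= n)%N
           end].

Record inhomogeneous_INAR1 (xi : nat -> nat -> {RV P >-> nat})
    (eps X : nat -> {RV P >-> nat}) : Prop := {
  INAR1_indep : mutually_independent innovation_index (innovations xi eps);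
  INAR1_ident : forall n j : nat, (1 <= n)%N -> (1 <= j)%N ->
    distribution P (xi n j) = distribution P (xi n 1%N);
  INAR1_bernoulli : forall n : nat, (1 <= n)%N ->
    P (xi n 1%N @^-1` [set 0%N; 1%N]) = 1%E;
  INAR1_init : forall w : T, X 0%N w = 0%N;
  INAR1_step : forall (n : nat) (w : T), (1 <= n)%N ->
    X n w = (\sum_(1 <= j < (X n.-1 w).+1) xi n j w + eps n w)%N
}.

(* [fine] loses nothing for an INAR(1) process: there xi n 1 is almost surely
   bounded by 1. *)
Definition offspring_mean (xi : nat -> nat -> {RV P >-> nat}) (n : nat) : R :=
  fine 'E_P[fun w => ((xi n 1%N w)%:R)%R]%E.

(* The factorial moment E Y(Y-1)...(Y-j+1), possibly +oo. *)
Definition factorial_moment (Y : {RV P >-> nat}) (j : nat) : \bar R :=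
  'E_P[fun w => ((Y w ^_ j)%:R)%R]%E.

Definition cvg_in_distribution (X : nat -> {RV P >-> nat})
    (nu : probability nat R) : Prop :=
  forall f : nat -> R, continuous f -> [bounded f k | k in [set: nat]] ->
    'E_P[fun w => f (X n w)]%E @[n --> \oo] --> (\int[nu]_k (f k)%:E)%E.

End INAR.

Definition expC (R : realType) (z : R[i]) : R[i] :=
  (expR (complex.Re z))%:C * (cos (complex.Im z) +i* sin (complex.Im z)).

(* nu = CP(mu): for |z| <= 1 the series of the exponent converges to some s and
   the generating function of nu at z converges to exp s. The topology of R[i]
   is carried by its alias R[i]^o. *)
Definition compound_Poisson (R : realType)
    (mu : {finite_measure set nat -> \bar R}) (nu : probability nat R) : Prop :=
  forall z : R[i], `|z| <= 1 ->
  exists2 s : R[i],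
    (\sum_(1 <= j < n) (fine (mu [set j]))%:C * (z ^+ j - 1) : R[i]^o)
      @[n --> \oo] --> (s : R[i]^o) &
    (\sum_(0 <= k < n) (fine (nu [set k]))%:C * z ^+ k : R[i]^o)
      @[n --> \oo] --> (expC s : R[i]^o).

Definition CP_weight (R : realType) (J : nat) (lambda : nat -> R) (j : nat) : R :=
  (j`!%:R)^-1 * \sum_(0 <= i < J - j) (-1) ^+ i / i`!%:R * lambda (j + i)%N.

(* Main.v *)
(** Let [G_n] be the generating function of [X_n], [r_n = 1 - rho_n], and let
[F = exp Psi] with [Psi (1 - w) = \sum_(l < J) lambda_l / l! (- w) ^ l], which
is the generating function of CP(mu).  Conditioning on [X_(n-1)] gives
[G_n (1 - w) = G_(n-1) (1 - (1 - r_n) w) H_n (1 - w)] with [H_n] the generating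
function of [eps_n].  The moment assumption and the Bonferroni-type bound
[|(1 - w)^x - \sum_(l < J) C(x, l) (- w)^l| <= C(x, J) w^J] show that [F] almost
solves this recursion, with an error [o(r_n) w]; hence [|G_n - F| (1 - w)] is
bounded by [e + (e + A exp (- \sum r_k)) w] for every [e > 0], and [G_n -> F] on
[[0, 1]].  Evaluating [P (eps_n >= j) / r_n] in the same way identifies its limit
as [j mu{j}], so that [mu >= 0].  Finally CP(mu) is realised by the explicit
weights [e^(- L) \sum_n [X^k] Q^n / n!], with [Q = \sum_j mu{j} X^j] and
[L = Q(1)]; nonnegativity of the coefficients controls the complex generating
function by its value at 1. *)
From HB Require Import structures.
Require Import Defs.
From mathcomp Require Import all_boot all_order all_algebra finmap complex.
From mathcomp Require Import all_classical all_reals all_analysis.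
From mathcomp Require Import measurable_realfun ring lra zify.
Import Order.TTheory GRing.Theory Num.Theory.
Import numFieldNormedType.Exports.
Local Open Scope classical_set_scope.
Local Open Scope ring_scope.

Set Implicit Arguments.
Unset Strict Implicit.
Unset Printing Implicit Defensive.

(** * Binomial expansions and the weights of [mu] *)

(** In the variable [w = 1 - z] the common fixed point [z = 1] of the offspring generating functions
    moves to the origin, and thinning becomes the scaling of [w] by [1 - r_n]. This is why the
    defect of [F] is kept in the form [o(r_n) w] and not merely [o(r_n)]: in a bound [e * w] each
    scaling frees [e * r_n * w], which pays for the defect, while the divergence of the series of
    [r_n] wipes out the initial discrepancy. The defect is that small for two reasons: to first
    order in [r_n] the change of [Psi] under the scaling cancels the leading term of [H_n - 1], and
    [lambda_J = 0] makes the Bonferroni remainder negligible against [r_n]. Early immigration may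
    have infinite moments, so [G_n] need not be Lipschitz at [w = 0]; hence the bounds of the form
    [e + A * w]. The sign of [mu{j}] is hidden in an alternating sum and is read off from its
    probabilistic meaning. Complex arguments concern CP(mu) alone; the process is handled on
    [[0, 1]]. *)

Lemma sum_bin_succ (R : comPzRingType) (a : nat -> R) (N x : nat) :
  \sum_(l < N.+1) a l *+ 'C(x.+1, l) =
  \sum_(l < N.+1) a l *+ 'C(x, l) + \sum_(l < N) a l.+1 *+ 'C(x, l).
Proof.
rewrite big_ord_recl [in RHS]big_ord_recl !bin0 -addrA; congr (_ + _).
rewrite -big_split /=; apply: eq_bigr => l _.
by rewrite /bump /= add1n binS mulrnDr.
Qed.

(** By Pascal's rule the remainder satisfies [rem_(J+1)(x+1) = rem_(J+1)(x) - w * rem_J(x)], and the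
    bound satisfies the same recursion with [+ w]; the triangle inequality then closes a double
    induction. *)
Lemma binomial_remainder (R : realFieldType) (w : R) (J x : nat) :
  0 <= w <= 1 ->
  `|(1 - w) ^+ x - \sum_(l < J) (- w) ^+ l *+ 'C(x, l)| <= w ^+ J *+ 'C(x, J).
Proof.
move=> /andP[w0 w1].
elim: J x => [|J IH] x.
  rewrite big_ord0 subr0 expr0 bin0 ger0_norm ?exprn_ge0 ?subr_ge0//.
  by rewrite exprn_ile1 ?subr_ge0// lerBlDr lerDl.
elim: x => [|x IHx].
  rewrite big_ord_recl big1 ?bin0 ?expr0 ?addr0 ?subrr ?normr0 ?bin0n ?mulr0n//.
rewrite sum_bin_succ binS mulrnDr exprS.
have -> : (1 - w) * (1 - w) ^+ x -
    (\sum_(l < J.+1) (- w) ^+ l *+ 'C(x, l) +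
     \sum_(l < J) (- w) ^+ l.+1 *+ 'C(x, l)) =
    ((1 - w) ^+ x - \sum_(l < J.+1) (- w) ^+ l *+ 'C(x, l)) +
    - w * ((1 - w) ^+ x - \sum_(l < J) (- w) ^+ l *+ 'C(x, l)).
  have -> : \sum_(l < J) (- w) ^+ l.+1 *+ 'C(x, l) =
      - w * \sum_(l < J) (- w) ^+ l *+ 'C(x, l).
    by rewrite mulr_sumr; apply: eq_bigr => l _; rewrite exprS mulrnAr.
  by ring.
apply: le_trans (ler_normD _ _) _; apply: lerD => //.
rewrite normrM normrN (ger0_norm w0) exprS -mulrnAr.
exact: ler_wpM2l.
Qed.

(** The Pascal matrix and its signed version are inverse to each other. Pascal's rule in [x] and in
    [l] at once lowers [N], [x] and [j] together by one. *)
Lemma binomial_inversion (R : comPzRingType) (N x j : nat) : (x < N)%N ->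
  \sum_(l < N) ((-1) ^+ (l + j) *+ 'C(l, j)) *+ 'C(x, l) = (x == j)%:R :> R.
Proof.
elim: N x j => // N IH [|x] j xN.
  rewrite big_ord_recl big1 ?addr0 ?bin0 ?bin0n ?add0n; last first.
    by move=> i _; rewrite bin0n mulr0n.
  by case: j => [|j]; rewrite ?bin0n ?mulr0n.
rewrite (sum_bin_succ (fun l => (-1) ^+ (l + j) *+ 'C(l, j))).
rewrite big_ord_recr /= (bin_small (xN : (x < N)%N)) mulr0n addr0 -big_split /=.
case: j => [|j].
  rewrite big1 // => l _; rewrite !bin0 !addn0 exprS mulN1r -mulrnDl.
  by rewrite subrr mul0rn.
rewrite eqSS -(IH x j xN); apply: eq_bigr => l _.
rewrite -mulrnDl binS !addnS addSn !exprS !mulN1r mulrnDr opprK.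
by rewrite addrA mulNrn addNr add0r.
Qed.

(* Newton coefficients of the indicator of [j < x], see [tail_indicatorE]. *)
Definition tail_coef {R : pzRingType} (j l : nat) : R :=
  if l is l'.+1 then (-1) ^+ (l' + j) *+ 'C(l', j) else 0.

Lemma tail_indicatorE (R : comPzRingType) (J x j : nat) : (x < J)%N ->
  (j < x)%:R = \sum_(l < J) tail_coef j l *+ 'C(x, l) :> R.
Proof.
case: J => // J; elim: x => [|x IH] xJ.
  by rewrite big_ord_recl /= mul0rn add0r big1// => l _; rewrite bin0n mulr0n.
rewrite sum_bin_succ -IH ?(ltn_trans _ xJ)//= binomial_inversion//.
by rewrite ltnS leq_eqVlt eq_sym; case: ltngtP => //= _; rewrite ?addr0 ?add0r.
Qed.

(** Trinomial revision: [C(J, l) * C(x, J) = C(x, l) * C(x - l, J - l)], and the last factor is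
    positive. *)
Lemma bin_small_le (x l J : nat) : (l <= J)%N -> (J <= x)%N ->
  ('C(x, l) <= 'C(J, l) * 'C(x, J))%N.
Proof.
move=> lJ Jx.
have := bin_fact Jx; have := bin_fact lJ; have := bin_fact (leq_trans lJ Jx).
have := @bin_fact (x - l) (J - l); rewrite leq_sub2r// => /(_ isT).
have -> : (x - l - (J - l) = x - J)%N by lia.
move=> h1 h2 h3 h4.
have f1 := fact_gt0 l; have f2 := fact_gt0 (J - l); have f3 := fact_gt0 (x - J).
have c1 : (0 < 'C(x - l, J - l))%N by rewrite bin_gt0 leq_sub2r.
suff -> : ('C(J, l) * 'C(x, J) = 'C(x, l) * 'C(x - l, J - l))%N by rewrite leq_pmulr.
apply/eqP; rewrite -(eqn_pmul2r f1) -(eqn_pmul2r f2) -(eqn_pmul2r f3); apply/eqP.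
transitivity x`!.
  by rewrite -h4 -h3; ring.
by rewrite -h2 -h1; ring.
Qed.

(** Below [J] the Newton polynomial is exact; from [J] on, [g] and each ['C(x, l)] are at most a
    constant times ['C(x, J)]. In expectation the error is thus governed by the [J]-th factorial
    moment. *)
Lemma newton_remainder (R : realFieldType) (g c : nat -> R) (J : nat) :
  (forall x, `|g x| <= 1) ->
  (forall x, (x < J)%N -> g x = \sum_(l < J) c l *+ 'C(x, l)) ->
  forall x, `|g x - \sum_(l < J) c l *+ 'C(x, l)| <=
    (1 + \sum_(l < J) `|c l| *+ 'C(J, l)) *+ 'C(x, J).
Proof.
move=> g1 gE x; case: (ltnP x J) => [xJ|Jx].
  by rewrite gE// subrr normr0 bin_small.
apply: le_trans (ler_normB _ _) _; rewrite mulrnDl; apply: lerD.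
  apply: le_trans (g1 x) _.
  by rewrite ler1n bin_gt0.
apply: le_trans (ler_norm_sum _ _ _) _; rewrite -sumrMnl.
apply: ler_sum => l _; rewrite normrMn -mulrnA.
by apply: ler_wpMn2l => //; rewrite bin_small_le// ltnW.
Qed.

(** The tangent inequality at [x] and at [- x] gives [0 <= expR x - 1 - x <= x * (expR x - 1)];
    using it once more bounds the last factor. *)
Lemma expR_taylor1 (R : realType) (x : R) :
  `|expR x - 1 - x| <= x ^+ 2 * expR `|x|.
Proof.
have h1 := expR_ge1Dx x.
have h2 := expR_ge1Dx (- x).
have e0 := expR_gt0 x.
have h3 : expR x - 1 <= x * expR x.
  have : (1 - x) * expR x <= 1.
    by rewrite -(ler_pdivlMr _ _ e0) div1r -expRN.
  by rewrite mulrBl mul1r; lra.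
rewrite ger0_norm; last lra.
have a1 : 1 <= expR `|x| by rewrite -expR0 ler_expR normr_ge0.
case: (lerP 0 x) => x0.
  by rewrite ger0_norm//; nra.
by nra.
Qed.

Lemma sum_nat1E (V : nmodType) (J : nat) (F : nat -> V) :
  \sum_(1 <= l < J) F l = \sum_(l < J) if val l is l'.+1 then F l'.+1 else 0.
Proof.
case: J => [|J]; first by rewrite big_geq// big_ord0.
by rewrite big_ord_recl /= add0r big_add1 big_mkord.
Qed.

(** The left side is what [P (eps_n > j) / r_n] tends to when the Newton expansion of the indicator
    is averaged, [E 'C(eps_n, l) / r_n] having the limit [l * lambda_l / l!]. Only [l > j]
    contributes, and [l = j.+1 + i] yields the sum in [CP_weight]. *)
Lemma CP_weight_tail (R : realType) (J : nat) (lambda : nat -> R) (j : nat) :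
  \sum_(l < J) tail_coef j l * (l%:R * lambda l) / l`!%:R =
  j.+1%:R * CP_weight J lambda j.+1.
Proof.
rewrite /CP_weight factS natrM invfM mulrA mulrA mulfV ?pnatr_eq0// mul1r.
transitivity (\sum_(0 <= l < J)
   tail_coef j l * (l%:R * lambda l) / l`!%:R).
  by rewrite big_mkord.
have tail0 l : (l < j.+1)%N -> tail_coef j l = 0 :> R.
  by case: l => // l lj; rewrite /tail_coef bin_small.
case: (leqP j.+1 J) => jJ; last first.
  rewrite [in RHS]big_geq; last lia.
  rewrite mulr0 big_nat big1// => l /andP[_ lJ].
  by rewrite tail0 ?mul0r//; lia.
rewrite (big_cat_nat (n := j.+1))//= [X in X + _]big1_seq ?add0r; last first.
  by move=> l; rewrite mem_index_iota => /andP[_ lj]; rewrite tail0 ?mul0r.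
rewrite -{1}[j.+1]add0n big_addn mulr_sumr; apply: eq_bigr => i _.
rewrite addnC addSn /= factS natrM.
have := @bin_fact (j + i) j (leq_addr _ _); rewrite addKn => <-.
rewrite !natrM addnAC addnn exprD -signr_odd odd_double expr0 mul1r.
have jf : j`!%:R != 0 :> R by rewrite pnatr_eq0 -lt0n fact_gt0.
have if_ : i`!%:R != 0 :> R by rewrite pnatr_eq0 -lt0n fact_gt0.
have bf : 'C(j + i, j)%:R != 0 :> R by rewrite pnatr_eq0 -lt0n bin_gt0 leq_addr.
have sf : (j + i).+1%:R != 0 :> R by rewrite pnatr_eq0.
rewrite -mulr_natr; field.
by rewrite jf if_ bf -natrD nat1r sf.
Qed.

(** Passage from the factorial cumulants [lambda_l] to the jump weights. The polynomial vanishes at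
    [z = 1], so after expansion in powers of [z] its value at 1 can be subtracted; this turns
    [z ^+ j] into [z ^+ j - 1] and disposes of the constant coefficient. *)
Lemma log_cp_expansion (R : realType) (J : nat) (lambda : nat -> R) (z : R) :
  \sum_(1 <= l < J) lambda l / l`!%:R * (z - 1) ^+ l =
  \sum_(1 <= j < J) CP_weight J lambda j * (z ^+ j - 1).
Proof.
pose a l := if l is l'.+1 then lambda l'.+1 / l'.+1`!%:R else 0.
pose nu j := \sum_(l < J) a l * (-1) ^+ (l - j) *+ 'C(l, j).
have E y : \sum_(1 <= l < J) lambda l / l`!%:R * (y - 1) ^+ l =
           \sum_(j < J) nu j * y ^+ j.
  rewrite sum_nat1E; under [RHS]eq_bigr do rewrite /nu mulr_suml.
  rewrite exchange_big /=; apply: eq_bigr => -[[|l] lJ] _ /=.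
    by rewrite big1// => i _; rewrite /= !mul0r mul0rn mul0r.
  rewrite addrC exprDn mulr_sumr.
  rewrite (big_ord_widen_cond J predT
    (fun i => lambda l.+1 / l.+1`!%:R *
       ((-1) ^+ (l.+1 - i) * y ^+ i *+ 'C(l.+1, i)))) //.
  rewrite big_mkcond; apply: eq_bigr => i _ /=; case: ltnP => il.
    by rewrite mulrnAr mulrA mulrnAl.
  by rewrite bin_small// mulr0n mul0r.
have E1 : \sum_(j < J) nu j * 1 ^+ j = 0.
  by rewrite -E subrr big_nat big1// => l /andP[l0 _]; rewrite expr0n gtn_eqF// mulr0.
rewrite E -[LHS]subr0 -[X in _ - X]E1 -sumrB sum_nat1E; apply: eq_bigr => -[[|j] jJ] _ /=.
  by rewrite !expr0 subrr.
rewrite expr1n -mulrBr; congr (_ * _).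
rewrite /CP_weight /nu -(big_mkord predT (fun l => a l * (-1) ^+ (l - j.+1) *+ 'C(l, j.+1))).
set F := _^-1.
rewrite (big_cat_nat (n := j.+1))//=; last exact: ltnW.
rewrite big1_seq ?add0r; last first.
  by move=> l; rewrite mem_index_iota => /andP[_ lj]; rewrite bin_small.
rewrite -{1}[j.+1]add0n big_addn mulr_sumr; apply: eq_bigr => i _.
rewrite addnK addnC addSn /a -addSn.
have := @bin_fact (j.+1 + i) j.+1 (leq_addr _ _); rewrite addKn => <-.
rewrite -mulr_natr natrM (natrM _ _ i`!) /F.
have jf : j.+1`!%:R != 0 :> R by rewrite pnatr_eq0 -lt0n fact_gt0.
have if_ : i`!%:R != 0 :> R by rewrite pnatr_eq0 -lt0n fact_gt0.
have bf : 'C(j.+1 + i, j.+1)%:R != 0 :> R by rewrite pnatr_eq0 -lt0n bin_gt0 leq_addr.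
move: jf if_ bf; move: (j.+1`!%:R) (i`!%:R) ('C(_, _)%:R) => A B D jf if_ bf.
by field; rewrite jf if_ bf.
Qed.

(** * One step of the recursion for the limit *)

Lemma power_taylor1 (R : realFieldType) (r : R) (l : nat) : 0 <= r <= 1 ->
  `|(1 - r) ^+ l - 1 + l%:R * r| <= l%:R ^+ 2 * r ^+ 2.
Proof.
move=> /andP[r0 r1]; elim: l => [|l].
  by rewrite expr0 subrr mul0r addr0 normr0 expr0n /= mul0r.
move=> IH; rewrite -natr1 exprS.
have -> : (1 - r) * (1 - r) ^+ l - 1 + (l%:R + 1) * r =
    (1 - r) * ((1 - r) ^+ l - 1 + l%:R * r) + l%:R * r ^+ 2 by ring.
apply: le_trans (ler_normD _ _) _.
rewrite normrM (@ger0_norm _ (1 - r)) ?subr_ge0//.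
rewrite (@ger0_norm _ (l%:R * _)) ?mulr_ge0 ?sqr_ge0 ?ler0n//.
set e := `|_| in IH *.
have e0 : 0 <= e by exact: normr_ge0.
have l0 : 0 <= l%:R :> R by rewrite ler0n.
have h : (1 - r) * e <= e by rewrite ler_piMl// lerBlDr lerDl.
have r2 : 0 <= r ^+ 2 by exact: sqr_ge0.
rewrite sqrrD mulr1 expr1n.
have : 0 <= (l%:R + 1) * r ^+ 2 by rewrite mulr_ge0// addr_ge0.
by lra.
Qed.

(* The logarithm of the limit generating function at [1 - w]. *)
Definition log_cp (R : realType) (J : nat) (lambda : nat -> R) (w : R) : R :=
  \sum_(1 <= l < J) lambda l / l`!%:R * (- w) ^+ l.

Lemma fact_ge1 (R : realFieldType) (n : nat) : 1 <= n`!%:R :> R.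
Proof. by rewrite ler1n fact_gt0. Qed.

(** The factor [l%:R ^+ 2] comes from [power_taylor1]; with it, one constant serves here and in
    [log_cp_increment]. *)
Lemma log_cp_bound (R : realType) (J : nat) (lambda : nat -> R) (w : R) :
  0 <= w <= 1 ->
  `|log_cp J lambda w| <= (\sum_(1 <= l < J) `|lambda l| * l%:R ^+ 2) * w.
Proof.
move=> /andP[w0 w1]; apply: le_trans (ler_norm_sum _ _ _) _.
rewrite mulr_suml; apply: ler_sum_nat => l /andP[l1 lJ].
rewrite !normrM normfV normrX normrN (ger0_norm w0) normr_nat.
apply: ler_pM; rewrite ?mulr_ge0 ?exprn_ge0 ?invr_ge0 ?ler0n//.
  apply: ler_wpM2l => //; apply: (@le_trans _ _ 1).
    by rewrite invf_le1 ?fact_ge1// ltr0n fact_gt0.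
  by rewrite -natrX ler1n expn_gt0 l1.
by rewrite -[leRHS]expr1 ler_wiXn2l.
Qed.

(** As [(1 - r) ^+ l] is [1 - l * r] up to [O(r ^+ 2)], scaling [w] changes the logarithm by minus
    the leading term of [H - 1] in [immigration_expansion]. This cancellation is what singles out
    the limit. *)
Lemma log_cp_increment (R : realType) (J : nat) (lambda : nat -> R) (r w : R) :
  0 <= r <= 1 -> 0 <= w <= 1 ->
  `|log_cp J lambda ((1 - r) * w) - log_cp J lambda w
    + r * \sum_(1 <= l < J) l%:R * lambda l / l`!%:R * (- w) ^+ l| <=
  (\sum_(1 <= l < J) `|lambda l| * l%:R ^+ 2) * (r ^+ 2 * w).
Proof.
move=> r01 /andP[w0 w1]; rewrite /log_cp -sumrB mulr_sumr -big_split /=.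
apply: le_trans (ler_norm_sum _ _ _) _.
rewrite mulr_suml; apply: ler_sum_nat => l /andP[l1 lJ].
rewrite -mulrN exprMn.
have -> : lambda l / l`!%:R * ((1 - r) ^+ l * (- w) ^+ l) -
   lambda l / l`!%:R * (- w) ^+ l + r * (l%:R * lambda l / l`!%:R * (- w) ^+ l) =
   lambda l * (l`!%:R^-1 * ((1 - r) ^+ l - 1 + l%:R * r) * (- w) ^+ l) by ring.
rewrite normrM -[leRHS]mulrA ler_wpM2l// normrM mulrA.
apply: ler_pM => //; last first.
  by rewrite normrX normrN (ger0_norm w0) -[leRHS]expr1 ler_wiXn2l.
rewrite normrM -[leRHS]mul1r; apply: ler_pM => //; last exact: power_taylor1.
by rewrite ger0_norm ?invr_ge0 ?ler0n// invf_le1 ?fact_ge1// ltr0n fact_gt0.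
Qed.

(** [b l] stands for the scaled moment [m_(n,l) / (l * r_n)], and the hypothesis is the Bonferroni
    bound for the generating function [H] of [eps_n]. Replacing [b] by [lambda] costs the listed
    differences, and [w ^+ l <= w] for [l >= 1] preserves the factor [w]. *)
Lemma immigration_expansion (R : realType) (J : nat) (lambda b : nat -> R)
    (r w H : R) : (1 <= J)%N -> 0 <= r -> 0 <= w <= 1 -> lambda J = 0 ->
  `|H - 1 - \sum_(1 <= l < J) (l%:R * r * b l) / l`!%:R * (- w) ^+ l| <=
     J%:R * r * b J / J`!%:R * w ^+ J ->
  `|H - 1 - r * \sum_(1 <= l < J) l%:R * lambda l / l`!%:R * (- w) ^+ l| <=
  (\sum_(1 <= l < J.+1) `|b l - lambda l|) * (r * w).
Proof.
move=> J1 r0 /andP[w0 w1] lJ0 Hb.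
have fin l : (1 <= l)%N -> `|l%:R / l`!%:R| <= 1 :> R.
  case: l => // l _; rewrite factS natrM invfM mulrA mulfV ?pnatr_eq0// mul1r.
  by rewrite ger0_norm ?invr_ge0 ?ler0n// invf_le1 ?fact_ge1// ltr0n fact_gt0.
have bd l (x y : R) : (1 <= l)%N -> `|l%:R / l`!%:R * x * (r * y ^+ l)| <=
    `|x| * (r * `|y| ^+ l).
  move=> l1; rewrite !normrM normrX (ger0_norm r0) -normrM ler_wpM2r//.
    by rewrite mulr_ge0// exprn_ge0.
  by rewrite -[leRHS]mul1r ler_wpM2r// fin.
have wl l : (1 <= l)%N -> `|w| ^+ l <= w.
  by move=> l1; rewrite (ger0_norm w0) -[leRHS]expr1 ler_wiXn2l.
rewrite big_nat_recr//= mulrDl [leRHS]addrC.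
set S := \sum_(1 <= l < J) _ in Hb; set S' := \sum_(1 <= l < J) l%:R * lambda l / _ * _.
have -> : H - 1 - r * S' = (H - 1 - S) + (S - r * S') by ring.
apply: le_trans (ler_normD _ _) _; apply: lerD.
  apply: le_trans Hb _.
  (* With [lambda J = 0] the Bonferroni remainder is absorbed by the term [l = J] of the error
     sum. *)
  rewrite lJ0 subr0.
  have -> : J%:R * r * b J / J`!%:R * w ^+ J = J%:R / J`!%:R * b J * (r * w ^+ J) by ring.
  apply: le_trans (ler_norm _) _; apply: le_trans (bd _ _ _ J1) _.
  by rewrite !ler_wpM2l// wl.
rewrite /S /S' mulr_sumr -sumrB.
apply: le_trans (ler_norm_sum _ _ _) _.
rewrite mulr_suml; apply: ler_sum_nat => l /andP[l1 lJ].
have -> : l%:R * r * b l / l`!%:R * (- w) ^+ l -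
    r * (l%:R * lambda l / l`!%:R * (- w) ^+ l) =
  l%:R / l`!%:R * (b l - lambda l) * (r * (- w) ^+ l) by ring.
apply: le_trans (bd _ _ _ l1) _.
by rewrite normrN !ler_wpM2l// wl.
Qed.

(** [K] depends on [J] and [lambda] only. With [b] the scaled moments of [eps_n] and [r = r_n], the
    bracket tends to 0, so the limit satisfies the recursion up to [o(r_n) w]. *)
Lemma INAR_step_bound (R : realType) (J : nat) (lambda : nat -> R) :
  (1 <= J)%N -> lambda J = 0 ->
  exists2 K : R, 0 <= K & forall (b : nat -> R) (r w H : R),
    0 <= r <= 1 -> 0 <= w <= 1 ->
    `|H - 1 - \sum_(1 <= l < J) (l%:R * r * b l) / l`!%:R * (- w) ^+ l| <=
      J%:R * r * b J / J`!%:R * w ^+ J ->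
    `|expR (log_cp J lambda ((1 - r) * w)) * H - expR (log_cp J lambda w)| <=
    K * (\sum_(1 <= l < J.+1) `|b l - lambda l| + r) * (r * w).
Proof.
move=> J1 lJ0.
pose C := \sum_(1 <= l < J) `|lambda l| * l%:R ^+ 2.
have C0 : 0 <= C by apply: sumr_ge0 => l _; rewrite mulr_ge0// exprn_ge0.
(* [expR C] bounds the prefactor [expR u] below; in the bracket, 1 pays for the error of [H], [C]
   for that of the logarithm, and the last term for [expR_taylor1] at [- t], where
   [|t| <= 2 * C * (r * w)]. *)
pose K := expR C * (1 + C + 4 * C ^+ 2 * expR (2 * C)).
exists K.
  by rewrite mulr_ge0 ?expR_ge0// !addr_ge0// !mulr_ge0 ?expR_ge0.
move=> b r w H /[dup] r01 /andP[r0 r1] /[dup] w01 /andP[w0 w1] Hb.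
have h1 := immigration_expansion J1 r0 w01 lJ0 Hb.
have h2 := log_cp_increment J lambda r01 w01.
set eta := \sum_(1 <= l < J.+1) _ in h1 *.
have eta0 : 0 <= eta by exact: sumr_ge0.
set a := \sum_(1 <= l < J) l%:R * _ / _ * _ in h1 h2.
have ha : `|a| <= C * w.
  apply: le_trans (ler_norm_sum _ _ _) _.
  rewrite mulr_suml; apply: ler_sum_nat => l /andP[l1 lJ].
  rewrite [X in `|X| <= _](_ : _ = lambda l * (l%:R / l`!%:R) * (- w) ^+ l); last by ring.
  rewrite normrM; apply: ler_pM => //; last first.
    by rewrite normrX normrN (ger0_norm w0) -[leRHS]expr1 ler_wiXn2l.
  rewrite normrM ler_wpM2l// ger0_norm ?divr_ge0// ler_pdivrMr ?ltr0n ?fact_gt0//.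
  apply: (@le_trans _ _ (l%:R ^+ 2)); first by rewrite -natrX ler_nat -{1}[l]expn1 leq_pexp2l.
  by rewrite ler_peMr ?exprn_ge0// fact_ge1.
have w'01 : 0 <= (1 - r) * w <= 1 by apply/andP; split; nra.
have h3 : log_cp J lambda ((1 - r) * w) <= C.
  apply: le_trans (ler_norm _) _; apply: le_trans (log_cp_bound _ _ w'01) _.
  by rewrite -/C; case/andP: w'01 => _ ?; rewrite ler_piMr.
rewrite -/C in h2.
set u := log_cp J lambda ((1 - r) * w) in h2 h3 *.
set v := log_cp J lambda w in h2 *.
(* [H] is close to [1 + r * a] and [t] to [- r * a], so [H] is compared with [expR (- t)] through
   their first-order parts. *)
pose t := u - v.
have -> : expR u * H - expR v = expR u * (H - expR (- t)).
  by rewrite mulrBr -expRD; congr (_ - expR _); rewrite /t; ring.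
rewrite normrM (ger0_norm (expR_ge0 _)).
have -> : K * (eta + r) * (r * w) = expR C *
    ((1 + C + 4 * C ^+ 2 * expR (2 * C)) * ((eta + r) * (r * w))) by rewrite /K; ring.
apply: ler_pM; rewrite ?expR_ge0// ?ler_expR//.
have rw0 : 0 <= r * w by rewrite mulr_ge0.
have tb : `|t| <= 2 * C * (r * w).
  have : `|t| <= `|t + r * a| + `|r * a|.
    by rewrite -{1}[t](addrK (r * a)); exact: ler_normB.
  move=> /le_trans; apply.
  have : `|r * a| <= C * (r * w).
    by rewrite normrM (ger0_norm r0) mulrCA ler_wpM2l.
  have : C * (r ^+ 2 * w) <= C * (r * w) by apply: ler_wpM2l => //; nra.
  by move: h2; rewrite -/t; lra.
have tC : `|t| <= 2 * C.
  by apply: le_trans tb _; apply: ler_piMr; [lra|nra].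
have h4 := expR_taylor1 (- t).
have h5 : `|H - expR (- t)| <= `|H - 1 - r * a| + `|t + r * a| + `|expR (- t) - 1 - - t|.
  have -> : H - expR (- t) = (H - 1 - r * a) + (t + r * a) - (expR (- t) - 1 - - t) by ring.
  by apply: le_trans (ler_normB _ _) _; rewrite lerD2r ler_normD.
have h6 : `|expR (- t) - 1 - - t| <= 4 * C ^+ 2 * expR (2 * C) * (r ^+ 2 * w).
  apply: le_trans h4 _; rewrite sqrrN normrN.
  have -> : 4 * C ^+ 2 * expR (2 * C) * (r ^+ 2 * w) =
    (4 * C ^+ 2 * (r ^+ 2 * w)) * expR (2 * C) by ring.
  apply: ler_pM; rewrite ?expR_ge0 ?sqr_ge0// ?ler_expR//.
  rewrite -real_normK ?num_real//.
  apply: le_trans (_ : (2 * C * (r * w)) ^+ 2 <= _).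
    by rewrite ler_sqr ?nnegrE// mulr_ge0//; lra.
  have -> : (2 * C * (r * w)) ^+ 2 = 4 * C ^+ 2 * (r ^+ 2 * (w * w)) by ring.
  apply: ler_wpM2l; first by rewrite mulr_ge0 ?sqr_ge0.
  by apply: ler_wpM2l; [rewrite sqr_ge0 | nra].
apply: le_trans h5 _; rewrite -/t in h2.
set D := 4 * C ^+ 2 * expR (2 * C) in h6 *.
have D0 : 0 <= D by rewrite /D !mulr_ge0 ?expR_ge0 ?sqr_ge0.
have -> : (1 + C + D) * ((eta + r) * (r * w)) =
    eta * (r * w) + C * (r ^+ 2 * w) + D * (r ^+ 2 * w) +
    (r * (r * w) + (C + D) * (eta * (r * w))) by ring.
have : 0 <= r * (r * w) + (C + D) * (eta * (r * w)).
  by rewrite addr_ge0 ?mulr_ge0 ?addr_ge0.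
by move: h1 h2 h6; rewrite -/t; lra.
Qed.

(** * The compound Poisson weights *)

Section complex_generating_function.
Local Open Scope complex_scope.

(** Defined over any field, so that complex partial sums can be compared with real ones. *)
Definition exp_sum (K : fieldType) (z : K) (N : nat) : K :=
  \sum_(n < N) z ^+ n / n`!%:R.

Lemma exp_sum_add (K : numFieldType) (x y : K) (N : nat) :
  exp_sum (x + y) N =
  \sum_(i < N) x ^+ i / i`!%:R * \sum_(0 <= j < N - i) y ^+ j / j`!%:R.
Proof.
transitivity (\sum_(n < N) \sum_(i < N | (i <= n)%N)
    x ^+ i / i`!%:R * (y ^+ (n - i) / (n - i)`!%:R)).
  apply: eq_bigr => -[n nN] _ /=.
  rewrite addrC exprDn mulr_suml.
  rewrite (big_ord_widen N (fun i => y ^+ (n - i) * x ^+ i *+ 'C(n, i) / n`!%:R))//.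
  apply: eq_big => [i|i]; first by rewrite ltnS.
  rewrite ltnS => ni; rewrite -(bin_fact ni) -mulr_natr !natrM.
  have h1 : i`!%:R != 0 :> K by rewrite pnatr_eq0 -lt0n fact_gt0.
  have h2 : (n - i)`!%:R != 0 :> K by rewrite pnatr_eq0 -lt0n fact_gt0.
  have h3 : 'C(n, i)%:R != 0 :> K by rewrite pnatr_eq0 -lt0n bin_gt0.
  by field; rewrite h1 h2 h3.
under eq_bigr do rewrite big_mkcond.
rewrite exchange_big /=; apply: eq_bigr => -[i iN] _ /=.
rewrite -big_mkcond /= mulr_sumr.
rewrite -(big_mkord (fun n => (i <= n)%N)
  (fun n => x ^+ i / i`!%:R * (y ^+ (n - i) / (n - i)`!%:R))).
rewrite (big_cat_nat (n := i))//=; last exact: ltnW.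
rewrite big_nat_cond big1 ?add0r; last by move=> k /andP[/andP[_ ki] ik]; lia.
rewrite -{1}(add0n i) big_addn.
by apply: eq_big => [k|k _]; rewrite ?leq_addl// addnK.
Qed.

Lemma exp_sum_mulB (K : numFieldType) (x y : K) (N : nat) :
  exp_sum x N * exp_sum y N - exp_sum (x + y) N =
  \sum_(i < N) x ^+ i / i`!%:R * \sum_(N - i <= j < N) y ^+ j / j`!%:R.
Proof.
rewrite exp_sum_add mulr_suml -sumrB; apply: eq_bigr => i _.
rewrite -mulrBr; congr (_ * _); rewrite /exp_sum -(big_mkord predT (fun j => y ^+ j / j`!%:R)).
by apply/eqP; rewrite subr_eq addrC; apply/eqP; exact/big_cat_nat/leq_subr.
Qed.

(** The difference is the sum over pairs [i, j < N] with [i + j >= N]. Taking norms termwise gives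
    the same expression at the norms of [x] and [y], so the complex error is dominated by a real
    one, which tends to 0 by [expRD]. *)
Lemma norm_exp_sum_mulB (K : numFieldType) (x y : K) (N : nat) :
  `|exp_sum x N * exp_sum y N - exp_sum (x + y) N| <=
  exp_sum `|x| N * exp_sum `|y| N - exp_sum (`|x| + `|y|) N.
Proof.
have nf (z : K) n : `|z ^+ n / n`!%:R| = `|z| ^+ n / n`!%:R.
  by rewrite normrM normrX normfV normr_nat.
rewrite !exp_sum_mulB; apply: le_trans (ler_norm_sum _ _ _) _.
apply: ler_sum => i _; rewrite normrM nf ler_wpM2l//.
by apply: le_trans (ler_norm_sum _ _ _) _; apply: ler_sum => j _; rewrite nf.
Qed.

Lemma cvg_exp_sum (R : realType) (x : R) : exp_sum x n @[n --> \oo] --> expR x.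
Proof.
have := is_cvg_series_exp_coeff x; rewrite /expR => /cvg_ex[l]/[dup] h /cvg_lim.
move=> ->//; rewrite (_ : exp_sum x = series (exp_coeff x))//.
by apply/funext => n; rewrite /exp_sum /series/= big_mkord.
Qed.

Lemma exp_sum_le (R : realType) (x : R) N : 0 <= x -> exp_sum x N <= expR x.
Proof.
move=> x0; rewrite -(cvg_lim _ (@cvg_exp_sum R x))//.
apply: nondecreasing_cvgn_le; last by apply/cvg_ex; exists (expR x); exact: cvg_exp_sum.
apply/nondecreasing_seqP => n; rewrite /exp_sum big_ord_recr /= lerDl.
by rewrite divr_ge0// exprn_ge0.
Qed.

Lemma normcR (R : rcfType) (x : R) : `|x%:C| = `|x|%:C :> R[i].
Proof. by rewrite normc_def /= expr0n/= addr0 sqrtr_sqr. Qed.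

Lemma exp_sumC (R : realType) (x : R) N : exp_sum (x%:C) N = (exp_sum x N)%:C.
Proof.
rewrite /exp_sum rmorph_sum; apply: eq_bigr => i _.
by rewrite rmorphM rmorphXn fmorphV /= rmorph_nat.
Qed.

Lemma exp_sum_im (R : realType) (b : R) N :
  exp_sum (0 +i* b) N =
  (series (cos_coeff b) N) +i* (series (sin_coeff b) N).
Proof.
have powi n : (0 +i* b) ^+ n =
    (((~~ odd n)%:R * (-1) ^+ n./2 * b ^+ n) +i*
     ((odd n)%:R * (-1) ^+ n.-1./2 * b ^+ n)) :> R[i].
  elim: n => [|n IH]; first by rewrite !expr0 /= !mul1r !mul0r.
  rewrite exprS IH /= !exprS uphalf_half.
  case: n {IH} => [|n] /=; first by simpc.
  rewrite negbK uphalf_half; case: (odd n) => /=; simpc.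
    by rewrite add1n exprS; congr Complex; ring.
  by rewrite add0n add1n [(-1) ^+ n./2.+1]exprS; congr Complex; ring.
rewrite /exp_sum /series /= !big_mkord.
elim: N => [|N IH]; first by rewrite !big_ord0.
rewrite !big_ord_recr /= IH powi.
have -> : N`!%:R^-1 = (N`!%:R^-1)%:C :> R[i] by rewrite fmorphV /= rmorph_nat.
by simpc.
Qed.

(** The error is given as a real null sequence, which keeps the topology of [R[i]] out of the
    estimates until [cvg_complex_squeeze]. *)
Lemma cvg_exp_sumC (R : realType) (s : R[i]) :
  exists2 x : nat -> R, x n @[n --> \oo] --> 0 &
    forall N, `|exp_sum s N - expC s| <= (x N)%:C.
Proof.
case: s => a b.
(* [d] bounds the defect of multiplicativity of the partial sums at the real and imaginary parts of
   [s]; [e] and [f] are the real and imaginary errors of their product. *)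
pose d N := exp_sum `|a| N * exp_sum `|b| N - exp_sum (`|a| + `|b|) N.
pose e N := exp_sum a N * series (cos_coeff b) N - expR a * cos b.
pose f N := exp_sum a N * series (sin_coeff b) N - expR a * sin b.
exists (fun N => d N + (`|e N| + `|f N|)).
  have -> : 0 = (expR `|a| * expR `|b| - expR (`|a| + `|b|)) +
     (`|expR a * cos b - expR a * cos b| + `|expR a * sin b - expR a * sin b|) :> R.
    by rewrite expRD !subrr normr0 !addr0.
  have cc : series (cos_coeff b) N @[N --> \oo] --> cos b.
    by rewrite unlock; exact: is_cvg_series_cos_coeff.
  have cs : series (sin_coeff b) N @[N --> \oo] --> sin b.
    by rewrite unlock; exact: is_cvg_series_sin_coeff.
  have ce := @cvg_exp_sum R.
  apply: cvgD; first by apply: cvgB => //; exact: cvgM.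
  apply: cvgD; apply: cvg_norm; apply: cvgB; try exact: cvg_cst; exact: cvgM.
move=> N.
have ab : a +i* b = a%:C + 0 +i* b :> R[i] by simpc.
have -> : exp_sum (a +i* b) N - expC (a +i* b) =
   - (exp_sum (a%:C) N * exp_sum (0 +i* b) N - exp_sum (a%:C + 0 +i* b) N) +
   (exp_sum (a%:C) N * exp_sum (0 +i* b) N - expC (a +i* b)).
  by rewrite ab; ring.
rewrite [leRHS]rmorphD; apply: le_trans (ler_normD _ _) _; apply: lerD.
  rewrite normrN; apply: le_trans (norm_exp_sum_mulB _ _ _) _.
  rewrite normcR.
  have -> : `|0 +i* b| = `|b|%:C :> R[i].
    by rewrite normc_def /= expr0n/= add0r sqrtr_sqr.
  by rewrite -rmorphD !exp_sumC -rmorphM -rmorphB.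
rewrite exp_sumC exp_sum_im /expC /=.
have -> : (exp_sum a N)%:C * (series (cos_coeff b) N +i* series (sin_coeff b) N)
   - (expR a)%:C * (cos b +i* sin b) = (e N)%:C + (0 +i* (f N)).
  by rewrite /e /f; simpc.
apply: le_trans (ler_normD _ _) _; rewrite [leRHS]rmorphD normcR lerD2l.
by rewrite normc_def /= expr0n/= add0r sqrtr_sqr.
Qed.

(** * Mass function of the compound Poisson law *)

Section CompoundPoissonPMF.
Context (R : realType) (J : nat) (m : nat -> R).
Hypothesis m_ge0 : forall j, (1 <= j < J)%N -> 0 <= m j.

Let jump : {poly R} := \poly_(j < J) (if j is j'.+1 then m j'.+1 else 0).
Let L : R := jump.[1].

(** The index [n] is the number of jumps, Poisson with mean [L]. As [jump] has no constant term,
    [jump ^+ n] starts at degree [n], so the sum over [n] may stop at [k]. *)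
Definition cp_pmf (k : nat) : R :=
  expR (- L) * \sum_(n < k.+1) (jump ^+ n)`_k / n`!%:R.

Lemma coef_jump_ge0 n k : 0 <= (jump ^+ n)`_k.
Proof.
elim: n k => [|n IH] k; first by rewrite expr0 coef1.
rewrite exprS coefM sumr_ge0// => i _; rewrite mulr_ge0//.
rewrite coef_poly; case: ifP => // iJ; case: (val i) iJ => // i' iJ.
exact: m_ge0.
Qed.

Lemma coef_jump_small n k : (k < n)%N -> (jump ^+ n)`_k = 0.
Proof.
elim: n k => // n IH k kn; rewrite exprS coefM big1// => -[[|i] ik] _ /=.
  by rewrite coef_poly/= if_same mul0r.
by rewrite IH ?mulr0//; lia.
Qed.

Lemma jumpE (z : R[i]) : (map_poly (real_complex R) jump).[z] =
  \sum_(1 <= j < J) (m j)%:C * z ^+ j.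
Proof.
rewrite (big_addn 0 J 1).
have -> : map_poly (real_complex R) jump =
    \poly_(j < J) (if j is j'.+1 then (m j'.+1)%:C else 0).
  apply/polyP => i; rewrite coef_map !coef_poly; case: ifP => // _.
  by case: i.
rewrite horner_poly; case: (J) => [|J']; first by rewrite big_ord0 big_geq.
rewrite big_ord_recl mul0r add0r subn1 /= big_mkord.
by apply: eq_bigr => i _; rewrite /bump /= addn1 add1n.
Qed.

(** Polynomial truncation of the exponential of [jump]. Its coefficients of degree below [N] have
    already reached [expR L * cp_pmf k], the others are nonnegative, and its values are exponential
    partial sums. *)
Let S N : {poly R} := \sum_(n < N) n`!%:R^-1 *: jump ^+ n.

Lemma coef_S_ge0 N k : 0 <= (S N)`_k.
Proof.
rewrite coef_sum sumr_ge0// => n _; rewrite coefZ mulr_ge0 ?invr_ge0//.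
exact: coef_jump_ge0.
Qed.

Lemma coef_S_cp N k : (k < N)%N -> (S N)`_k = expR L * cp_pmf k.
Proof.
move=> kN; rewrite /cp_pmf mulrA -expRD subrr expR0 mul1r coef_sum.
rewrite (big_ord_widen N (fun n => (jump ^+ n)`_k / n`!%:R))// [RHS]big_mkcond /=.
apply: eq_bigr => n _; rewrite coefZ mulrC; case: ifP => // /negbT.
by rewrite -leqNgt => kn; rewrite coef_jump_small ?mul0r.
Qed.

Lemma S_le N N' k : (N <= N')%N -> (S N)`_k <= (S N')`_k.
Proof.
move=> NN'; rewrite !coef_sum (big_ord_widen N' (fun n => (n`!%:R^-1 *: jump ^+ n)`_k))//.
rewrite [leLHS]big_mkcond; apply: ler_sum => n _; case: ifP => // _.
by rewrite coefZ mulr_ge0 ?invr_ge0 ?coef_jump_ge0.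
Qed.

Lemma horner_S (z : R[i]) N : (map_poly (real_complex R) (S N)).[z] =
  exp_sum (\sum_(1 <= j < J) (m j)%:C * z ^+ j) N.
Proof.
rewrite -jumpE /S rmorph_sum horner_sum; apply: eq_bigr => n _.
by rewrite /= map_polyZ hornerZ rmorphXn horner_exp fmorphV rmorph_nat mulrC.
Qed.

Lemma horner_S1 N : (S N).[1] = exp_sum L N.
Proof.
rewrite /S horner_sum; apply: eq_bigr => n _.
by rewrite hornerZ horner_exp mulrC.
Qed.

Lemma cp_pmf_ge0 k : 0 <= cp_pmf k.
Proof.
by rewrite -(pmulr_rge0 _ (expR_gt0 L)) -(coef_S_cp (ltnSn k)) coef_S_ge0.
Qed.

Lemma L_ge0 : 0 <= L.
Proof.
rewrite /L horner_coef sumr_ge0// => i _; rewrite expr1n mulr1.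
by have := coef_jump_ge0 1 i; rewrite expr1.
Qed.

Lemma cp_pmf_sum_le1 N : \sum_(k < N) cp_pmf k <= 1.
Proof.
rewrite -(ler_pM2l (expR_gt0 L)) mulr1 mulr_sumr.
apply: le_trans (_ : (S N).[1] <= _); last by rewrite horner_S1 exp_sum_le// L_ge0.
rewrite (@horner_coef_wide _ (maxn N (size (S N)))) ?leq_maxr//.
rewrite (big_ord_widen (maxn N (size (S N))) (fun k => expR L * cp_pmf k)) ?leq_maxl//.
rewrite [leLHS]big_mkcond; apply: ler_sum => k _; rewrite expr1n mulr1.
by case: ifP => [kN|_]; [rewrite coef_S_cp | exact: coef_S_ge0].
Qed.

Lemma cvg_cp_pmf_sum : \sum_(k < N) cp_pmf k @[N --> \oo] --> (1 : R).
Proof.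
apply/cvgrPdist_le => e e0.
have e0' : 0 < e * expR L by rewrite mulr_gt0 ?expR_gt0.
have /cvgrPdist_le/(_ _ e0')[M _ HM] := @cvg_exp_sum R L.
have {}HM := HM M (leqnn M).
(* Past the degree of [S M] the sum over [k < N] catches every coefficient of [S M], hence its value
   at 1. *)
exists (maxn M (size (S M))) => // N /=; rewrite geq_max => /andP[MN SN].
rewrite ger0_norm ?subr_ge0 ?cp_pmf_sum_le1// lerBlDl.
rewrite -(ler_pM2l (expR_gt0 L)) mulr1 mulrDr mulr_sumr.
apply: le_trans (_ : exp_sum L M + e * expR L <= _).
  by rewrite -lerBlDl; apply: le_trans HM; rewrite ler_norm.
rewrite [e * _]mulrC lerD2r -horner_S1 (horner_coef_wide _ SN).
apply: ler_sum => k _; rewrite expr1n mulr1 -(@coef_S_cp N)//.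
exact: S_le.
Qed.

Lemma cp_pmf_pgf (z : R[i]) : `|z| <= 1 ->
  exists2 x : nat -> R, x n @[n --> \oo] --> 0 & forall N,
  `|\sum_(0 <= k < N) (cp_pmf k)%:C * z ^+ k
    - expC (\sum_(1 <= j < J) (m j)%:C * (z ^+ j - 1))| <= (x N)%:C.
Proof.
move=> z1; set s := \sum_(1 <= j < J) _.
pose q := \sum_(1 <= j < J) (m j)%:C * z ^+ j.
have sE : s = q - L%:C.
  have -> : L%:C = \sum_(1 <= j < J) (m j)%:C.
    rewrite /L -(horner_map (real_complex R)) rmorph1 jumpE.
    by apply: eq_bigr => j _; rewrite expr1n mulr1.
  by rewrite -sumrB; apply: eq_bigr => j _; rewrite mulrBr mulr1.
have expE : expC s = (expR (- L))%:C * expC q.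
  rewrite sE /expC; case: (q) => a b; simpc.
  by rewrite /= expRD; congr Complex; ring.
have [x x0 Hx] := cvg_exp_sumC q.
(* The first term bounds, by their sum at [z = 1], the terms of [expR (- L)] times [S N] of degree
   at least [N]; the second is the error of the exponential partial sum at [q]. *)
exists (fun N => (1 - \sum_(k < N) cp_pmf k) + expR (- L) * x N).
  have : (1 - \sum_(k < N) cp_pmf k) + expR (- L) * x N @[N --> \oo] -->
      (1 - 1) + expR (- L) * 0.
    apply: cvgD; last exact: cvgMr.
    by apply: cvgB; [exact: cvg_cst | exact: cvg_cp_pmf_sum].
  by rewrite subrr mulr0 addr0.
move=> N.
have -> : \sum_(0 <= k < N) (cp_pmf k)%:C * z ^+ k - expC s =
  - ((expR (- L))%:C * exp_sum q N - \sum_(0 <= k < N) (cp_pmf k)%:C * z ^+ k) +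
  (expR (- L))%:C * (exp_sum q N - expC q) by rewrite expE; ring.
rewrite [leRHS]rmorphD; apply: le_trans (ler_normD _ _) _; apply: lerD; last first.
  rewrite normrM normcR (ger0_norm (expR_ge0 _)) rmorphM ler_wpM2l//.
  by rewrite lecR expR_ge0.
rewrite normrN -horner_S.
pose M := maxn N (size (S N)).
have NM : (N <= M)%N by rewrite leq_maxl.
have SM : (size (S N) <= M)%N by rewrite leq_maxr.
have SM' : (size (map_poly (real_complex R) (S N)) <= M)%N.
  by rewrite size_map_poly.
have coefE k : (expR (- L))%:C * (map_poly (real_complex R) (S N))`_k =
  (expR (- L) * (S N)`_k)%:C by rewrite coef_map rmorphM.
rewrite (horner_coef_wide _ SM') mulr_sumr.
rewrite -(big_mkord predT (fun k => (expR (- L))%:C *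
  ((map_poly (real_complex R) (S N))`_k * z ^+ k))) /=.
rewrite (big_cat_nat (n := N))//=.
rewrite (_ : \sum_(0 <= k < N) (expR (- L))%:C * _ =
  \sum_(0 <= k < N) (cp_pmf k)%:C * z ^+ k); last first.
  apply: eq_big_nat => k /andP[_ kN]; rewrite mulrA coefE coef_S_cp// mulrA.
  by rewrite -expRD addNr expR0 mul1r.
rewrite addrAC subrr add0r.
apply: le_trans (ler_norm_sum _ _ _) _.
apply: le_trans (_ : \sum_(N <= k < M) (expR (- L) * (S N)`_k)%:C <= _).
  apply: ler_sum => k _; rewrite mulrA coefE normrM normcR.
  rewrite (@ger0_norm _ (expR (- L) * _)) ?mulr_ge0 ?expR_ge0 ?coef_S_ge0// ler_piMr//.
    by rewrite lecR mulr_ge0 ?expR_ge0 ?coef_S_ge0.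
  by rewrite normrX exprn_ile1.
rewrite -rmorph_sum lecR lerBrDl.
rewrite -(big_mkord predT cp_pmf).
rewrite (_ : \sum_(0 <= k < N) cp_pmf k =
   \sum_(0 <= k < N) expR (- L) * (S N)`_k); last first.
  apply: eq_big_nat => k /andP[_ kN]; rewrite coef_S_cp// mulrA.
  by rewrite -expRD addNr expR0 mul1r.
rewrite -(big_cat_nat (n := N))//= -mulr_sumr big_mkord.
rewrite -(ler_pM2l (expR_gt0 L)) mulrA -expRD subrr expR0 mul1r mulr1.
apply: le_trans (exp_sum_le N L_ge0).
rewrite -horner_S1 (horner_coef_wide _ SM).
by apply: ler_sum => k _; rewrite expr1n mulr1.
Qed.

End CompoundPoissonPMF.

End complex_generating_function.

(** * Independence and the generating function recursion *)

Lemma measurable_nat (A : set nat) : measurable A.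
Proof. by []. Qed.

Lemma measurable_fun_nat d (T : measurableType d) (g : nat -> T) :
  measurable_fun setT g.
Proof. by []. Qed.

Section weights.
Context (d : measure_display) (T : measurableType d) (R : realType)
  (P : probability T R) (I : choiceType) (D0 : set I) (Y : I -> {RV P >-> nat}).
Hypothesis indepY : mutually_independent D0 Y.
Local Open Scope ereal_scope.

Let cyl (s : {fset I}) (A : I -> set nat) : set T :=
  \bigcap_(i in [set` s]) (Y i @^-1` A i).

(* [V] is independent of every event depending on finitely many [Y i] with
   [i \in D].  Working with weights instead of events, this class is closed under
   countable sums, which covers functionals of random sums. *)
Definition indep_weight (D : set I) (V : T -> \bar R) : Prop :=
  [/\ measurable_fun setT V, forall w, 0 <= V w &
   forall (s : {fset I}) (A : I -> set nat), [set` s] `<=` D ->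
     \int[P]_(w in cyl s A) V w = \int[P]_w V w * P (cyl s A)].

Lemma indep_weight_measurable D V : indep_weight D V -> measurable_fun setT V.
Proof. by case. Qed.

Lemma indep_weight_ge0 D V : indep_weight D V -> forall w, 0 <= V w.
Proof. by case. Qed.

Lemma measurable_cyl s A : measurable (cyl s A).
Proof.
apply: fin_bigcap_measurable => // i _.
by rewrite -[_ @^-1` _]setTI; exact: measurable_funP.
Qed.

Lemma indep_weight_sub D D' V : D' `<=` D -> indep_weight D V -> indep_weight D' V.
Proof. by move=> DD [mV V0 iV]; split=> // s A sD; apply: iV; exact: subset_trans DD. Qed.

Lemma indep_weight_cst D (c : R) : (0 <= c)%R -> indep_weight D (cst c%:E).
Proof.
move=> c0; split=> [||s A sD]; first exact: measurable_cst.
  by move=> w; rewrite lee_fin.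
rewrite integral_cst; last exact: measurable_cyl.
by rewrite integral_cst//= probability_setT mule1.
Qed.

Lemma indep_weight_scale D (c : R) V : (0 <= c)%R -> indep_weight D V ->
  indep_weight D (fun w => c%:E * V w).
Proof.
move=> c0 [mV V0 iV]; split.
- exact: measurable_funeM.
- by move=> w; rewrite mule_ge0// lee_fin.
- move=> s A sD; rewrite !ge0_integralZl_EFin// ?iV ?muleA//; last first.
    exact: measurable_funTS.
  exact: measurable_cyl.
Qed.

Lemma indep_weight_series D (V : (T -> \bar R)^nat) :
  (forall n, indep_weight D (V n)) -> indep_weight D (fun w => \sum_(n <oo) V n w).
Proof.
move=> iV.
have mV n : measurable_fun setT (V n) by case: (iV n).
have V0 n w : 0 <= V n w by case: (iV n).
split.
- exact: ge0_emeasurable_sum.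
- by move=> w; exact: nneseries_ge0.
- move=> s A sD; have mc := measurable_cyl s A.
  have Pc : P (cyl s A) \is a fin_num by exact: fin_num_measure.
  rewrite integral_nneseries//; last by move=> n; exact: measurable_funTS.
  rewrite [X in _ = X * _]integral_nneseries//.
  rewrite -[P (cyl s A)]fineK//.
  rewrite muleC -nneseriesZl => [|n _]; last exact: integral_ge0.
  apply: eq_eseriesr => n _; rewrite muleC fineK//.
  by case: (iV n) => _ _ ->.
Qed.

(** A cylinder over [s] intersected with [Y i = b] is a cylinder over [s] with [i] adjoined, still
    inside [D], so the property of [V] applies to it and independence of [Y] splits off the factor
    of [i]. The index [i] is then spent, hence [D] without [i]. *)
Lemma indep_weight_indicator D V i b : D `<=` D0 -> indep_weight D V -> D i ->
  indep_weight (D `\ i) (fun w => V w * (Y i w == b)%:R%:E) /\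
  \int[P]_w (V w * (Y i w == b)%:R%:E) = \int[P]_w V w * P (Y i @^-1` [set b]).
Proof.
move=> DD0 [mV V0 iV] Di.
have mY : measurable (Y i @^-1` [set b]).
  by rewrite -[_ @^-1` _]setTI; exact: measurable_funP.
have m1 : measurable_fun setT (fun w => V w * (Y i w == b)%:R%:E).
  apply: emeasurable_funM => //; apply/measurable_EFinP.
  exact: (measurableT_comp (measurable_fun_nat (fun k => (k == b)%:R : R))).
have E B : measurable B -> \int[P]_(w in B) (V w * (Y i w == b)%:R%:E) =
    \int[P]_(w in B `&` Y i @^-1` [set b]) V w.
  move=> mB; rewrite integral_mkcondr; apply: eq_integral => w _.
  rewrite patchE; case: ifPn; rewrite ?inE ?notin_setE /=.
    by move=> ->; rewrite eqxx mule1.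
  by move=> /eqP/negbTE ->; rewrite mule0.
have EY : \int[P]_w (V w * (Y i w == b)%:R%:E) = \int[P]_w V w * P (Y i @^-1` [set b]).
  rewrite E//; have := iV [fset i]%fset (fun=> [set b]).
  rewrite /cyl set_fset1 bigcap_set1 setTI; apply.
  by move=> j /= ->.
split=> //; split=> //.
  by move=> w; rewrite mule_ge0// lee_fin.
move=> s A sD; rewrite EY E; last exact: measurable_cyl.
pose A' j := if j == i then [set b] else A j.
have is_ : i \notin s.
  by apply/negP => /sD [_]; apply.
have AA' : cyl s A' = cyl s A.
  apply: eq_bigcapr => j /= js; rewrite /A'; case: eqP => // ji.
  by move: is_; rewrite -ji js.
have cylU : cyl (i |` s)%fset A' = cyl s A `&` Y i @^-1` [set b].
  by rewrite /cyl set_fsetU1 bigcap_setU1 -/(cyl s A') AA' /A' eqxx setIC.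
have isD : [set` (i |` s)%fset] `<=` D.
  by rewrite set_fsetU1 => j [->//|/sD []].
have isD0 := subset_trans isD DD0.
have sD0 : [set` s] `<=` D0 by move=> j /sD [/DD0].
rewrite -cylU iV//.
rewrite [P (cyl _ _)](indepY isD0 (fun _ _ => measurable_nat _)).
rewrite -AA' [P (cyl _ _)](indepY sD0 (fun _ _ => measurable_nat _)).
by rewrite big_fsetU1//= muleA /A' eqxx.
Qed.

Lemma series_single (f : nat -> \bar R) k : 0 <= f k ->
  (forall j, j != k -> f j = 0) -> \sum_(j <oo) f j = f k.
Proof.
move=> fk f0; rewrite (@nneseriesD1 _ _ k)//=; last first.
  by move=> j _; case: (eqVneq j k) => [->//|/f0 ->].
by rewrite eseries0 ?adde0// => j _ /f0.
Qed.

Lemma integral_nat_rv (X : {RV P >-> nat}) (g : nat -> R) : (forall k, (0 <= g k)%R) ->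
  \int[P]_w (g (X w))%:E = \sum_(k <oo) (g k)%:E * P (X @^-1` [set k]).
Proof.
move=> g0.
transitivity (\int[P]_w \sum_(k <oo) ((g k)%:E * (\1_(X @^-1` [set k]) w)%:E)).
  apply: eq_integral => w _; rewrite (series_single (k := X w)).
  - by rewrite indicE mem_set// mule1.
  - by rewrite mule_ge0// lee_fin.
  - move=> j /eqP jX; rewrite indicE memNset ?mule0//= => /esym.
    exact: jX.
have mX k : measurable (X @^-1` [set k]).
  by rewrite -[_ @^-1` _]setTI; exact: measurable_funP.
rewrite integral_nneseries//.
- apply: eq_eseriesr => k _; rewrite ge0_integralZl_EFin// ?integral_indic ?setIT//.
  by apply/measurable_EFinP; exact: measurable_indic.
- move=> k; apply: measurable_funeM; apply/measurable_EFinP.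
  exact: measurable_indic.
- by move=> k w _; rewrite mule_ge0// lee_fin.
Qed.

(** [g (Y i)] is the countable combination of the indicators of [Y i = b] with weights [g b]. *)
Lemma indep_weight_mul D V i (g : nat -> R) : D `<=` D0 -> indep_weight D V -> D i ->
  (forall k, (0 <= g k)%R) -> \int[P]_w V w \is a fin_num ->
  indep_weight (D `\ i) (fun w => V w * (g (Y i w))%:E) /\
  \int[P]_w (V w * (g (Y i w))%:E) = \int[P]_w V w * \int[P]_w (g (Y i w))%:E.
Proof.
move=> DD0 iV Di g0 Vfin.
have V0 w : 0 <= V w by case: iV.
have ib b := indep_weight_indicator b DD0 iV Di.
have ib' b := indep_weight_scale (g0 b) (proj1 (ib b)).
have E : (fun w => V w * (g (Y i w))%:E) =
    (fun w => \sum_(b <oo) ((g b)%:E * (V w * (Y i w == b)%:R%:E))).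
  apply/funext => w; rewrite (series_single (k := Y i w)).
  - by rewrite eqxx mule1 muleC.
  - by rewrite mule_ge0 ?lee_fin// mule_ge0// lee_fin.
  - by move=> j; rewrite eq_sym => /negbTE ->; rewrite !mule0.
split; first by rewrite E; exact: indep_weight_series.
rewrite E integral_nneseries//; last 2 first.
- by move=> b; exact: indep_weight_measurable (ib' b).
- by move=> b w _; exact: indep_weight_ge0 (ib' b) w.
rewrite integral_nat_rv// -[\int[P]_w V w]fineK// -nneseriesZl; last first.
  by move=> b _; rewrite mule_ge0// lee_fin.
apply: eq_eseriesr => b _; rewrite ge0_integralZl_EFin//; last 2 first.
- by move=> w _; exact: indep_weight_ge0 (proj1 (ib b)) w.
- exact: indep_weight_measurable (proj1 (ib b)).
by rewrite (proj2 (ib b)) fineK// muleCA.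
Qed.

Lemma indep_weight_add D (V : T -> \bar R) (S : T -> nat) i : D `<=` D0 -> D i ->
  (forall w, 0 <= V w) ->
  (forall k, indep_weight D (fun w => V w * (S w == k)%:R%:E)) ->
  forall k, indep_weight (D `\ i) (fun w => V w * ((S w + Y i w)%N == k)%:R%:E).
Proof.
move=> DD0 Di V0 iS k.
have ib b := proj1 (indep_weight_indicator b DD0 (iS (k - b)%N) Di).
(* Truncated subtraction turns [k - b] into 0 when [b > k]; the scalar [(b <= k)%N] cancels those
   terms. *)
have ib' b := indep_weight_scale (ler0n R (b <= k)%N) (ib b).
have := indep_weight_series ib'; congr indep_weight.
apply/funext => w; rewrite (series_single (k := Y i w)).
- rewrite eqxx mule1 muleCA -EFinM -natrM mulnb; congr (_ * _%:R%:E).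
  by apply/esym; congr nat_of_bool; lia.
- by rewrite !mule_ge0// lee_fin.
- by move=> j; rewrite eq_sym => /negbTE ->; rewrite !mule0.
Qed.

End weights.

(** * Independence of past and future, and the generating function of one generation *)

Section INAR_pgf.
Context (d : measure_display) (T : measurableType d) (R : realType)
  (P : probability T R) (xi : nat -> nat -> {RV P >-> nat})
  (eps X : nat -> {RV P >-> nat}).
Hypothesis HX : inhomogeneous_INAR1 xi eps X.
Local Open Scope ereal_scope.

Let Y := innovations xi eps.
Let indepY : mutually_independent innovation_index Y := INAR1_indep HX.
Let level (i : (nat * nat) + nat) : nat :=
  match i with inl nj => nj.1 | inr n => n end.
Let after (n : nat) : set ((nat * nat) + nat) :=
  innovation_index `&` [set i | (n < level i)%N].
(* Innovations still unused once [xi n.+1 1, ..., xi n.+1 j] have been added. *)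
Let after_offspring (n j : nat) : set ((nat * nat) + nat) :=
  after n `&` [set i | match i with
                       | inl nj => ~~ ((nj.1 == n.+1) && (nj.2 <= j)%N)
                       | inr _ => true
                       end].
Let S n j w : nat := (\sum_(1 <= i < j.+1) xi n.+1 i w)%N.

Let after_sub n : after n `<=` innovation_index.
Proof. exact: subIsetl. Qed.

Let after_offspring_sub n j : after_offspring n j `<=` innovation_index.
Proof. by apply: subset_trans (@after_sub n); exact: subIsetl. Qed.

Let after_offspring_next n j : after_offspring n j (inl (n.+1, j.+1)).
Proof. by split; [split => /= | rewrite /= ltnn andbF]. Qed.

Let after_offspring_eps n j : after_offspring n j (inr n.+1).
Proof. by split=> //; split=> /=. Qed.

Let after_offspringS n j :
  after_offspring n j.+1 `<=` after_offspring n j `\ inl (n.+1, j.+1).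
Proof.
move=> [[a b]|a] [h1 h2]; split=> //; last 1 first.
- by move=> [aE bE]; move: h2; rewrite /= aE bE eqxx leqnn.
- split=> //; move: h2 => /=; case: eqVneq => //= _.
  by rewrite -!ltnNge; exact: ltnW.
Qed.

Let afterS n j : after n.+1 `<=` after_offspring n j `\ inr n.+1.
Proof.
move=> [[a b]|a] [h1 /= h2]; split=> //.
- split; first by split=> //=; exact: ltnW.
  by rewrite /= (gtn_eqF h2).
- by split=> //; split=> //=; exact: ltnW.
- by move=> [aE]; move: h2; rewrite aE ltnn.
Qed.

Let S0 n w : S n 0 w = 0%N. Proof. by rewrite /S big_geq. Qed.

Let SS n j w : S n j.+1 w = (S n j w + Y (inl (n.+1, j.+1)) w)%N.
Proof. by rewrite /S big_nat_recr. Qed.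

Let XS n w : X n.+1 w = (S n (X n w) w + Y (inr n.+1) w)%N.
Proof. by rewrite (INAR1_step HX). Qed.

Let offspring_weight n j m k :
  indep_weight (P := P) Y (after n) (fun w => (X n w == m)%:R%:E) ->
  indep_weight (P := P) Y (after_offspring n j)
    (fun w => (X n w == m)%:R%:E * (S n j w == k)%:R%:E).
Proof.
move=> hX; elim: j k => [|j IH] k.
  apply: (@indep_weight_sub _ _ _ _ _ _ (after n)); first exact: subIsetl.
  have := indep_weight_scale (ler0n R (k == 0)%N) hX; congr indep_weight.
  by apply/funext => w; rewrite S0 muleC [k == _]eq_sym.
apply: indep_weight_sub (@after_offspringS n j) _.
under eq_fun do rewrite SS.
apply: (indep_weight_add indepY (@after_offspring_sub n j)
  (@after_offspring_next n j) _ IH) => w.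
by rewrite lee_fin.
Qed.

(** Splitting on [X n = m] replaces the random number of offspring by the fixed number [m], for
    which one innovation is consumed at a time; the pieces are summed back over [m]. *)
Lemma INAR1_indep_future n k :
  indep_weight (P := P) Y (after n) (fun w => (X n w == k)%:R%:E).
Proof.
elim: n k => [|n IH] k.
  under eq_fun do rewrite (INAR1_init HX).
  exact: indep_weight_cst.
have h m : indep_weight (P := P) Y (after n.+1) (fun w => (X n w == m)%:R%:E *
    ((S n m w + Y (inr n.+1) w)%N == k)%:R%:E).
  apply: indep_weight_sub (@afterS n m) _.
  apply: (indep_weight_add indepY (@after_offspring_sub n m)
    (@after_offspring_eps n m) _ (fun l => offspring_weight m l (IH m))) => w.
  by rewrite lee_fin.
have := indep_weight_series h; congr indep_weight.
apply/funext => w; rewrite (series_single (k := X n w)) ?eqxx ?mul1e.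
- by rewrite XS.
- by rewrite lee_fin.
- by move=> j; rewrite eq_sym => /negbTE ->; rewrite mul0e.
Qed.

Lemma integral_nat_bounded (Z : {RV P >-> nat}) (g : nat -> R) :
  (forall k, (0 <= g k <= 1)%R) ->
  0 <= \int[P]_w (g (Z w))%:E <= 1.
Proof.
move=> g01; apply/andP; split.
  by apply: integral_ge0 => w _; rewrite lee_fin; case/andP: (g01 (Z w)).
rewrite -(@probability_setT _ _ _ P) -[leRHS]mul1e -integral_cst//.
apply: ge0_le_integral => //.
- by move=> w _; rewrite lee_fin; case/andP: (g01 (Z w)).
- by apply/measurable_EFinP; exact: (measurableT_comp (measurable_fun_nat g)).
- by move=> w _; rewrite lee_fin; case/andP: (g01 (Z w)).
Qed.

Lemma integral_offspring n j (g : nat -> R) : (forall k, (0 <= g k <= 1)%R) ->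
  \int[P]_w (g (xi n.+1 j.+1 w))%:E = \int[P]_w (g (xi n.+1 1%N w))%:E.
Proof.
move=> g01.
have mg : measurable_fun setT (EFin \o g) by [].
have g0 k : 0 <= (EFin \o g) k by rewrite lee_fin; case/andP: (g01 k).
have E i := ge0_integral_distribution (xi n.+1 i) mg g0.
by rewrite -[LHS]E -[RHS]E (INAR1_ident HX).
Qed.

Lemma integral_bernoulli n (z : R) : (0 <= z <= 1)%R ->
  \int[P]_w (z ^+ xi n.+1 1%N w)%:E =
  (1 - offspring_mean xi n.+1 + offspring_mean xi n.+1 * z)%:E.
Proof.
move=> /andP[z0 z1].
have B : P (xi n.+1 1%N @^-1` [set 0%N; 1%N]) = 1 := INAR1_bernoulli HX (ltn0Sn n).
have mxi A : measurable (xi n.+1 1%N @^-1` A).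
  by rewrite -[_ @^-1` _]setTI; exact: measurable_funP.
pose p0 := fine (P (xi n.+1 1%N @^-1` [set 0%N])).
pose p1 := fine (P (xi n.+1 1%N @^-1` [set 1%N])).
have p0E : P (xi n.+1 1%N @^-1` [set 0%N]) = p0%:E by rewrite fineK// fin_num_measure.
have p1E : P (xi n.+1 1%N @^-1` [set 1%N]) = p1%:E by rewrite fineK// fin_num_measure.
have p01 : (p0 + p1 = 1)%R.
  apply: EFin_inj; rewrite EFinD -p0E -p1E -B preimage_setU measureU//.
  by apply/seteqP; split=> // w [/= -> ].
have pk k : (1 < k)%N -> P (xi n.+1 1%N @^-1` [set k]) = 0.
  move=> k1; apply/eqP; rewrite -measure_le0.
  have := @probability_setC _ _ _ P _ (mxi [set 0%N; 1%N]).
  rewrite B subee// => <-; apply: le_measure; rewrite ?inE//; first exact: measurableC.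
  by move=> w /= -> [] kE; move: k1; rewrite kE.
have E (g : nat -> R) : (forall k, (0 <= g k)%R) ->
    \int[P]_w (g (xi n.+1 1%N w))%:E = (g 0%N * p0 + g 1%N * p1)%:E.
  move=> g0; rewrite integral_nat_rv// (nneseries_split 0 2); last first.
    by move=> k _; rewrite mule_ge0// lee_fin.
  rewrite eseries0 ?adde0; last by move=> k k1 _; rewrite pk// mule0.
  by rewrite big_nat_recr//= big_nat1 p0E p1E -!EFinM -EFinD.
have -> : offspring_mean xi n.+1 = p1.
  rewrite /offspring_mean unlock (E (fun k => k%:R))//.
  by rewrite mul0r mul1r add0r.
rewrite (E (fun k => z ^+ k)%R) => [|k]; last exact: exprn_ge0.
have -> : p0 = (1 - p1)%R by rewrite -p01 addrK.
by congr (_%:E); ring.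
Qed.

Lemma offspring_mean_ge0 n : (0 <= offspring_mean xi n)%R.
Proof. by rewrite fine_ge0//; apply: expectation_ge0 => w; exact: ler0n. Qed.

Lemma INAR1_pgf n (z : R) : (0 <= z <= 1)%R ->
  \int[P]_w (z ^+ X n.+1 w)%:E =
  \int[P]_w ((1 - offspring_mean xi n.+1 + offspring_mean xi n.+1 * z) ^+ X n w)%:E *
  \int[P]_w (z ^+ eps n.+1 w)%:E.
Proof.
move=> z01; have [z0 z1] := andP z01.
set phi := (1 - _ + _)%R.
have zk k : (0 <= z ^+ k <= 1)%R by rewrite exprn_ge0// exprn_ile1.
have zk0 k : (0 <= z ^+ k)%R by rewrite exprn_ge0.
have phiE j : \int[P]_w (z ^+ xi n.+1 j.+1 w)%:E = phi%:E.
  by rewrite (integral_offspring n j zk) integral_bernoulli.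
have phi0 : (0 <= phi)%R.
  by rewrite -lee_fin -(phiE 0%N); case/andP: (integral_nat_bounded (xi n.+1 1%N) zk).
have mX m : measurable (X n @^-1` [set m]).
  by rewrite -[_ @^-1` _]setTI; exact: measurable_funP.
have EX m : \int[P]_w (X n w == m)%:R%:E = P (X n @^-1` [set m]).
  transitivity (\int[P]_w (\1_(X n @^-1` [set m]) w)%:E).
    by apply: eq_integral => w _; rewrite indicE; case: eqP => e;
      [rewrite mem_set | rewrite memNset].
  by rewrite integral_indic// setIT.
have PXfin m : P (X n @^-1` [set m]) \is a fin_num by exact: fin_num_measure.
have h m j : indep_weight (P := P) Y (after_offspring n j)
      (fun w => (X n w == m)%:R%:E * (z ^+ S n j w)%:E) /\
    \int[P]_w ((X n w == m)%:R%:E * (z ^+ S n j w)%:E) =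
    (phi ^+ j)%:E * P (X n @^-1` [set m]).
  elim: j => [|j [IH1 IH2]].
    under eq_fun do rewrite S0 expr0 mule1.
    rewrite EX expr0 mul1e; split=> //.
    by apply: indep_weight_sub (INAR1_indep_future n m); exact: subIsetl.
  have := indep_weight_mul indepY (@after_offspring_sub n j) IH1
    (@after_offspring_next n j) zk0.
  rewrite IH2 fin_numM// => /(_ isT) [H1 H2].
  have SE w : (X n w == m)%:R%:E * (z ^+ S n j.+1 w)%:E =
     (X n w == m)%:R%:E * (z ^+ S n j w)%:E * (z ^+ Y (inl (n.+1, j.+1)) w)%:E.
    by rewrite SS exprD EFinM muleA.
  under eq_fun do rewrite SE.
  split; first exact: indep_weight_sub (@after_offspringS n j) H1.
  by rewrite H2 phiE exprS EFinM [RHS]muleAC [X in X * _]muleC muleC muleA.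
(* On [X n = m] this is [z ^+ X n.+1], elsewhere 0. Its integral is [phi ^+ m * P (X n = m)] times
   the immigration factor, and summing over [m] rebuilds the generating function of [X n] at
   [phi]. *)
pose W m w := (X n w == m)%:R%:E * (z ^+ S n m w)%:E * (z ^+ eps n.+1 w)%:E.
have HW m : measurable_fun setT (W m) /\
    \int[P]_w W m w = (phi ^+ m)%:E * P (X n @^-1` [set m]) * \int[P]_w (z ^+ eps n.+1 w)%:E.
  have [h1 h2] := h m m.
  have := indep_weight_mul indepY (@after_offspring_sub n m) h1
    (@after_offspring_eps n m) zk0.
  rewrite h2 fin_numM// => /(_ isT) [H1 H2]; split=> //.
  exact: indep_weight_measurable H1.
have W0 m w : 0 <= W m w by rewrite /W !mule_ge0// lee_fin.
have -> : \int[P]_w (z ^+ X n.+1 w)%:E = \int[P]_w (\sum_(m <oo) W m w).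
  apply: eq_integral => w _; rewrite (series_single (k := X n w))//.
    by rewrite /W eqxx mul1e XS exprD EFinM.
  by move=> j; rewrite /W eq_sym => /negbTE ->; rewrite !mul0e.
rewrite integral_nneseries//; last by move=> m; exact: (HW m).1.
have /andP[e0 e1] := integral_nat_bounded (eps n.+1) zk.
have efin : \int[P]_w (z ^+ eps n.+1 w)%:E \is a fin_num.
  by rewrite ge0_fin_numE//; apply: le_lt_trans e1 _; rewrite ltry.
rewrite integral_nat_rv => [|k]; last exact: exprn_ge0.
rewrite -[\int[P]_w (z ^+ eps n.+1 w)%:E]fineK// muleC -nneseriesZl; last first.
  by move=> m _; rewrite mule_ge0// lee_fin exprn_ge0.
by apply: eq_eseriesr => m _; rewrite (HW m).2 muleC fineK.
Qed.

End INAR_pgf.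

(** * Probabilities on the natural numbers *)

(** [D n] plays the distance to the limit as a function of [w]. The hypothesis with [e + A * w] is a
    weak form of vanishing at [w = 0], since a Lipschitz bound may fail when [X n] has infinite
    mean. *)
Lemma perturbed_contraction_cvg0 (R : realType) (D : nat -> R -> R)
    (r delta : nat -> R) (N : nat) :
  (forall n, 0 <= r n.+1 <= 1) ->
  \sum_(1 <= k < n.+1) r k @[n --> \oo] --> +oo ->
  delta n @[n --> \oo] --> 0 ->
  (forall n w, 0 <= D n w) ->
  (forall n (e : R), 0 < e -> exists2 A, 0 <= A &
     forall w, 0 <= w <= 1 -> D n w <= e + A * w) ->
  (forall n w, (N <= n)%N -> 0 <= w <= 1 ->
    D n.+1 w <= D n ((1 - r n.+1) * w) + delta n.+1 * (r n.+1 * w)) ->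
  forall w, 0 <= w <= 1 -> D n w @[n --> \oo] --> 0.
Proof.
move=> r01 rdiv delta0 D0 Dini Drec w0 w001.
apply/cvgrPdist_le => e' e'0.
pose e := e' / 3; have e0 : 0 < e by rewrite divr_gt0.
have /cvgrPdist_le/(_ _ e0)[N1 _ HN1] := delta0.
pose M := maxn N N1.
have [A A0 HA] := Dini M e e0.
pose s n := \sum_(1 <= k < n.+1) r k.
(* One step keeps this bound: scaling [w] by [1 - r] releases [e * r * w], which covers the
   perturbation as [delta <= e], and [1 - r <= expR (- r)] updates the factor of [A]. *)
have claim i w : 0 <= w <= 1 ->
    D (M + i)%N w <= e + (e + A * expR (s M - s (M + i)%N)) * w.
  elim: i w => [|i IH] w /[dup] w01 /andP[w_0 w_1].
    rewrite addn0 subrr expR0 mulr1; apply: le_trans (HA w w01) _.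
    by rewrite lerD2l ler_wpM2r// lerDr ltW.
  rewrite addnS; set n := (M + i)%N in IH *.
  have nN : (N <= n)%N by rewrite /n /M; lia.
  have nN1 : (N1 <= n.+1)%N by rewrite /n /M; lia.
  have /andP[r0 r1] := r01 n.
  have d1 : delta n.+1 <= e.
    by have := HN1 n.+1 nN1; rewrite sub0r normrN; exact/le_trans/ler_norm.
  apply: le_trans (Drec n w nN w01) _.
  have w'01 : 0 <= (1 - r n.+1) * w <= 1 by apply/andP; split; nra.
  have h1 := IH _ w'01.
  have rw0 : 0 <= r n.+1 * w by rewrite mulr_ge0.
  have h2 : delta n.+1 * (r n.+1 * w) <= e * (r n.+1 * w) by rewrite ler_wpM2r.
  have -> : s M - s n.+1 = (s M - s n) - r n.+1.
    by rewrite /s [X in _ - X](@big_nat_recr _ _ _ n.+1)//= opprD addrA.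
  rewrite expRD; set E := expR (s M - s n) in h1 *.
  have E0 : 0 <= E := expR_ge0 _.
  have h3 : A * E * ((1 - r n.+1) * w) <= A * (E * expR (- r n.+1)) * w.
    rewrite !mulrA ler_wpM2r// ler_wpM2l ?mulr_ge0//.
    by have := expR_ge1Dx (- r n.+1).
  have -> : e + (e + A * (E * expR (- r n.+1))) * w =
    e + e * w + A * (E * expR (- r n.+1)) * w by ring.
  have h4 : e + (e + A * E) * ((1 - r n.+1) * w) =
    e + e * w - e * (r n.+1 * w) + A * E * ((1 - r n.+1) * w) by ring.
  by lra.
have E0 : A * expR (s M) * expR (- s n) @[n --> \oo] --> 0.
  rewrite -(mulr0 (A * expR (s M))); apply: cvgMr.
  exact: (cvg_comp _ _ rdiv (@cvgr_expR R)).
have /cvgrPdist_le/(_ _ e0)[N2 _ HN2] := E0.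
exists (maxn M N2) => // n /=; rewrite geq_max => /andP[Mn N2n].
rewrite sub0r normrN ger0_norm//.
have := claim (n - M)%N w0 w001; rewrite subnKC//.
have := HN2 n N2n; rewrite sub0r normrN ger0_norm; last by rewrite !mulr_ge0 ?expR_ge0.
rewrite -mulrA -expRD.
have := mulr_ge0 A0 (expR_ge0 (s M - s n)); set B := A * _.
have /andP[h0 h1] := w001 => B0 B1 B2.
have : (e + B) * w0 <= e + B by rewrite ler_piMr// addr_ge0// ltW.
have : e' = e + e + e by rewrite /e; lra.
by lra.
Qed.

(** * Measures on the natural numbers given by their masses *)

Section pmf_measure.
Context (R : realType) (p : nat -> R).
Local Open Scope ereal_scope.

(** Here and in the two variants below the hypothesis is an argument, so that the term itself
    determines its measure structure. *)
Definition pmf_measure of (forall k, (0 <= p k)%R) : set nat -> \bar R :=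
  fun U => \esum_(k in U) (p k)%:E.

Hypothesis p_ge0 : forall k, (0 <= p k)%R.

Let pmf_measure0 : pmf_measure p_ge0 set0 = 0.
Proof. exact: esum_set0. Qed.

Let pmf_measure_ge0 U : 0 <= pmf_measure p_ge0 U.
Proof. by apply: esum_ge0 => k _; rewrite lee_fin. Qed.

Let pmf_measure_sigma_additive : semi_sigma_additive (pmf_measure p_ge0).
Proof.
move=> F mF tF mUF; apply: cvg_toP.
  apply: ereal_nondecreasing_is_cvgn => a b ab.
  by apply: lee_sum_nneg_natr => // n _ _; exact: pmf_measure_ge0.
by rewrite /pmf_measure nneseries_sum_bigcup// => i; rewrite lee_fin.
Qed.

HB.instance Definition _ := isMeasure.Build _ _ _ (pmf_measure p_ge0)
  pmf_measure0 pmf_measure_ge0 pmf_measure_sigma_additive.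

Lemma pmf_measure1 k : pmf_measure p_ge0 [set k] = (p k)%:E.
Proof. by rewrite /pmf_measure esum_set1// lee_fin. Qed.

Lemma pmf_measureT : pmf_measure p_ge0 setT = \sum_(k <oo) (p k)%:E.
Proof. by rewrite /pmf_measure -nneseries_esumT// => k; rewrite lee_fin. Qed.

Hypothesis p_sum : \sum_(k <oo) (p k)%:E < +oo.

Definition finite_pmf_measure of \sum_(k <oo) (p k)%:E < +oo := pmf_measure p_ge0.

HB.instance Definition _ := Measure.on (finite_pmf_measure p_sum).

Let finite_pmf : fin_num_fun (finite_pmf_measure p_sum).
Proof.
apply: lty_fin_num_fun; rewrite /finite_pmf_measure.
by move: p_sum; rewrite -pmf_measureT.
Qed.

HB.instance Definition _ :=
  Measure_isFinite.Build _ _ _ (finite_pmf_measure p_sum) finite_pmf.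

Hypothesis p_sum1 : \sum_(k <oo) (p k)%:E = 1.

Definition pmf_probability of \sum_(k <oo) (p k)%:E = 1 := pmf_measure p_ge0.

HB.instance Definition _ := Measure.on (pmf_probability p_sum1).

Let pmf_probabilityT : pmf_probability p_sum1 setT = 1.
Proof. by rewrite /pmf_probability pmf_measureT. Qed.

HB.instance Definition _ :=
  Measure_isProbability.Build _ _ _ (pmf_probability p_sum1) pmf_probabilityT.

End pmf_measure.

Lemma cvg_sumr (R : realType) (I : eqType) (r : seq I) (u : I -> nat -> R) (l : I -> R) :
  (forall i, i \in r -> u i n @[n --> \oo] --> l i) ->
  \sum_(i <- r) u i n @[n --> \oo] --> \sum_(i <- r) l i.
Proof.
elim: r => [|i r IH] H.
  by under eq_fun do rewrite big_nil; rewrite big_nil; exact: cvg_cst.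
under eq_fun do rewrite big_cons; rewrite big_cons.
apply: cvgD; first by apply: H; rewrite mem_head.
by apply: IH => j jr; apply: H; rewrite in_cons jr orbT.
Qed.

Lemma probability_lty d (T : measurableType d) (R : realType)
  (P : probability T R) : (P setT < +oo)%E.
Proof. by rewrite probability_setT ltry. Qed.

Lemma bounded_integrable_rv d (T : measurableType d) (R : realType)
    (P : probability T R) (Z : {RV P >-> nat}) (g : nat -> R) (M : R) :
  (forall k, `|g k| <= M) -> P.-integrable setT (EFin \o (fun w => g (Z w))).
Proof.
move=> gM; apply: measurable_bounded_integrable => //.
- exact: probability_lty.
- exact: (measurableT_comp (measurable_fun_nat g)).
- by exists M; split; [exact: num_real | move=> x Mx w _; exact: le_trans (gM _) (ltW Mx)].
Qed.

(** * Generating functions, masses and bounded test functions *)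

Section nat_probability.
Context (R : realType).
Implicit Types (Q nu : probability nat R) (f g : nat -> R).

Definition pmf_nat Q (k : nat) : R := fine (Q [set k]).

Lemma pmf_nat_ge0 Q k : 0 <= pmf_nat Q k.
Proof. by rewrite fine_ge0. Qed.

Lemma bounded_integrable_nat Q f (M : R) : (forall k, `|f k| <= M) ->
  Q.-integrable setT (EFin \o f).
Proof.
move=> fM; apply: measurable_bounded_integrable => //.
  exact: probability_lty.
by exists M; split; [exact: num_real | move=> x Mx k _; exact: le_trans (fM k) (ltW Mx)].
Qed.

Lemma Rintegral_finite_support Q (c : nat -> R) K :
  Q.-integrable setT (EFin \o (fun k => \sum_(j < K) c j * (k == j :> nat)%:R)) /\
  \int[Q]_k (\sum_(j < K) c j * (k == j :> nat)%:R) = \sum_(j < K) c j * pmf_nat Q j.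
Proof.
have iI j : Q.-integrable setT (EFin \o (fun k => (k == j)%:R)).
  by apply: (@bounded_integrable_nat _ _ 1) => k; case: eqP; rewrite ?normr1 ?normr0.
have EI j : \int[Q]_k (k == j)%:R = pmf_nat Q j.
  rewrite /Rintegral /pmf_nat -[in RHS](setIT [set j]) -integral_indic//.
  congr fine; apply: eq_integral => k _; rewrite indicE.
  by case: eqP => e; [rewrite mem_set | rewrite memNset].
have iZ j : Q.-integrable setT (EFin \o (fun k => c j * (k == j)%:R)).
  by apply: (@bounded_integrable_nat _ _ `|c j|) => k; case: eqP; rewrite ?mulr1 ?mulr0 ?normr0.
elim: K => [|K [IH1 IH2]].
  split; last by under eq_Rintegral do rewrite big_ord0; rewrite big_ord0 Rintegral_cst// mul0r.
  by apply: (@bounded_integrable_nat _ _ 0) => k; rewrite big_ord0 normr0.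
have E k : \sum_(j < K.+1) c j * (k == j :> nat)%:R =
    \sum_(j < K) c j * (k == j :> nat)%:R + c K * (k == K)%:R by rewrite big_ord_recr.
split.
  have := integrableD (@measurableT _ nat) IH1 (iZ K).
  by apply: eq_integrable => // k _ /=; rewrite E EFinD.
under eq_Rintegral do rewrite E.
by rewrite RintegralD// IH2 RintegralZl// EI big_ord_recr.
Qed.

Lemma finite_supportE g K k :
  \sum_(j < K) g j * (k == j :> nat)%:R = if (k < K)%N then g k else 0.
Proof.
case: ltnP => kK.
  rewrite (bigD1 (Ordinal kK))//= eqxx mulr1 big1 ?addr0// => j jk.
  rewrite (_ : (k == j) = false) ?mulr0//; apply/eqP => e.
  by move/eqP: jk; apply; apply/val_inj.
rewrite big1// => j _; rewrite gtn_eqF ?mulr0//; exact: leq_trans (ltn_ord j) kK.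
Qed.

(** [B] ensures integrability, while [M] bounds [g] beyond [K] and may be much smaller:
    [pgf_cvg_pmf] takes [M = z ^+ k.+1]. *)
Lemma nat_probability_tail Q g (M B : R) (K : nat) :
  (forall k, `|g k| <= B) -> (forall k, (K <= k)%N -> `|g k| <= M) ->
  `|\int[Q]_k g k - \sum_(k < K) g k * pmf_nat Q k| <=
  M * (1 - \sum_(k < K) pmf_nat Q k).
Proof.
move=> gB gM.
have ig := bounded_integrable_nat Q gB.
have [i1 e1] := Rintegral_finite_support Q g K.
have [i2 e2] := Rintegral_finite_support Q (fun=> 1) K.
have e2' : \sum_(j < K) 1 * pmf_nat Q j = \sum_(k < K) pmf_nat Q k.
  by apply: eq_bigr => j _; rewrite mul1r.
have i3 : Q.-integrable setT (EFin \o (fun=> 1 : R)).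
  by apply: (@bounded_integrable_nat _ _ 1) => k; rewrite normr1.
rewrite -e1 -RintegralB//.
have i4 : Q.-integrable setT (EFin \o
    (fun k => g k - \sum_(j < K) g j * (k == j :> nat)%:R)).
  have := integrableB (@measurableT _ nat) ig i1.
  by apply: eq_integrable => // k _ /=; rewrite EFinB.
have i5 : Q.-integrable setT (EFin \o
    (fun k => 1 - \sum_(j < K) 1 * (k == j :> nat)%:R)).
  have := integrableB (@measurableT _ nat) i3 i2.
  by apply: eq_integrable => // k _ /=; rewrite EFinB.
apply: le_trans (le_normr_Rintegral _ i4) _ => //.
have -> : 1 - \sum_(k < K) pmf_nat Q k =
    \int[Q]_k (1 - \sum_(j < K) 1 * (k == j :> nat)%:R).
  rewrite RintegralB// e2 e2' Rintegral_cst//.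
  rewrite mul1r; congr (_ - _); rewrite -[LHS]/(fine 1%E); congr fine.
  by apply/esym; exact: probability_setT.
rewrite -RintegralZl//; apply: le_Rintegral => //.
- exact: integrable_norm.
- by have := integrableZl (@measurableT _ nat) M i5.
move=> k _; rewrite finite_supportE (finite_supportE (fun=> 1)).
case: ltnP => kK; first by rewrite !subrr normr0 mulr0.
by rewrite !subr0 mulr1 gM.
Qed.

Lemma cvg_pmf_nat_sum Q : \sum_(k < K) pmf_nat Q k @[K --> \oo] --> (1 : R).
Proof.
have h : (\sum_(0 <= k < K) Q [set k])%E @[K --> \oo] --> Q setT.
  have -> : [set: nat] = \bigcup_k [set k].
    by apply/seteqP; split => // k _; exists k.
  apply: measure_semi_sigma_additive => //.
  apply/trivIsetP => i j _ _ ij; apply/seteqP; split => // k [/= ->].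
  by move/eqP; rewrite (negbTE ij).
rewrite probability_setT in h.
have /fine_cvgP[_] := h; apply: cvg_trans; apply: near_eq_cvg.
near=> K; rewrite /= big_mkord.
rewrite (eq_bigr (fun k : 'I_K => (pmf_nat Q k)%:E)) ?sumEFin//.
by move=> k _; rewrite fineK// fin_num_measure.
Unshelve. all: by end_near. Qed.

Lemma pmf_nat_sum_le1 Q K : \sum_(k < K) pmf_nat Q k <= 1.
Proof.
rewrite -(cvg_lim _ (cvg_pmf_nat_sum Q))//.
apply: nondecreasing_cvgn_le; last by apply/cvg_ex; exists 1; exact: cvg_pmf_nat_sum.
by apply/nondecreasing_seqP => n; rewrite big_ord_recr lerDl pmf_nat_ge0.
Qed.

(** Once the masses below [k] converge, the generating function at a small fixed [z] determines
    [z ^+ k] times the mass at [k] up to [z ^+ k.+1]; dividing by [z ^+ k] leaves an error of order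
    [z]. *)
Lemma pgf_cvg_pmf (Q : nat -> probability nat R) nu :
  (forall z, 0 <= z <= 1 ->
    \int[Q n]_k (z ^+ k) @[n --> \oo] --> \int[nu]_k (z ^+ k)) ->
  forall k, pmf_nat (Q n) k @[n --> \oo] --> pmf_nat nu k.
Proof.
move=> H; elim/ltn_ind => k IH.
apply/cvgrPdist_le => e e0.
(* The tails of [nu] and of [Q n] each cost [z ^+ k.+1 <= e / 4 * z ^+ k]; the other [e / 2] is left
   for [b n]. *)
pose z := Num.min 1 (e / 4).
have z0 : 0 < z by rewrite lt_min ltr01 divr_gt0.
have z1 : z <= 1 by rewrite ge_min lexx.
have ze : z <= e / 4 by rewrite ge_min lexx orbT.
have z01 : 0 <= z <= 1 by rewrite ltW.
have zk0 : 0 < z ^+ k by rewrite exprn_gt0.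
have tail Q' : `|\int[Q']_i (z ^+ i) - \sum_(i < k.+1) z ^+ i * pmf_nat Q' i| <= z ^+ k.+1.
  have := @nat_probability_tail Q' (fun i => z ^+ i) (z ^+ k.+1) 1 k.+1.
  have zi i : 0 <= z ^+ i by rewrite exprn_ge0// ltW.
  have h1 i : `|z ^+ i| <= 1 by rewrite ger0_norm// exprn_ile1// ltW.
  have h2 i : (k.+1 <= i)%N -> `|z ^+ i| <= z ^+ k.+1.
    by move=> ki; rewrite ger0_norm// ler_wiXn2l// ltW.
  move=> /(_ h1 h2) /le_trans; apply.
  by rewrite ler_piMr// lerBlDr lerDl sumr_ge0// => i _; exact: pmf_nat_ge0.
pose b n := `|\int[nu]_i (z ^+ i) - \int[Q n]_i (z ^+ i)| +
   \sum_(i < k) `|pmf_nat nu i - pmf_nat (Q n) i|.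
have b0 : b n @[n --> \oo] --> 0.
  have -> : 0 = `|\int[nu]_i (z ^+ i) - \int[nu]_i (z ^+ i)| +
      \sum_(i < k) `|pmf_nat nu i - pmf_nat nu i| :> R.
    by rewrite subrr normr0 add0r big1// => i _; rewrite subrr normr0.
  apply: cvgD; first by apply: cvg_norm; apply: cvgB; [exact: cvg_cst | exact: H].
  apply: cvg_sumr => i _; apply: cvg_norm; apply: cvgB; first exact: cvg_cst.
  exact: IH.
have ez0 : 0 < e / 2 * z ^+ k by rewrite mulr_gt0// divr_gt0.
have /cvgrPdist_le/(_ _ ez0) := b0.
apply: filterS => n; rewrite sub0r normrN => /(le_trans (ler_norm _)) bn.
rewrite -(ler_pM2r zk0).
pose t Q' := \int[Q']_i (z ^+ i) - \sum_(i < k.+1) z ^+ i * pmf_nat Q' i.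
have E Q' : z ^+ k * pmf_nat Q' k =
    \int[Q']_i (z ^+ i) - \sum_(i < k) z ^+ i * pmf_nat Q' i - t Q'.
  by rewrite /t big_ord_recr /=; ring.
rewrite -{1}(gtr0_norm zk0) -normrM mulrC mulrBr !E.
have -> : \int[nu]_i (z ^+ i) - \sum_(i < k) z ^+ i * pmf_nat nu i - t nu -
  (\int[Q n]_i (z ^+ i) - \sum_(i < k) z ^+ i * pmf_nat (Q n) i - t (Q n)) =
  (\int[nu]_i (z ^+ i) - \int[Q n]_i (z ^+ i)) -
  \sum_(i < k) z ^+ i * (pmf_nat nu i - pmf_nat (Q n) i) - (t nu - t (Q n)).
  rewrite [X in _ = _ - X - _](_ : _ = \sum_(i < k) z ^+ i * pmf_nat nu i -
      \sum_(i < k) z ^+ i * pmf_nat (Q n) i); first by ring.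
  by rewrite -sumrB; apply: eq_bigr => i _; rewrite mulrBr.
apply: le_trans (ler_normB _ _) _.
have h1 : `|t nu - t (Q n)| <= e / 2 * z ^+ k.
  apply: le_trans (ler_normB _ _) _.
  have := tail nu; have := tail (Q n); rewrite -!/(t _) exprS.
  have : z * z ^+ k <= e / 4 * z ^+ k by rewrite ler_wpM2r// ltW.
  have -> : e / 2 * z ^+ k = e / 4 * z ^+ k + e / 4 * z ^+ k by field.
  by lra.
have h2 : `|\int[nu]_i (z ^+ i) - \int[Q n]_i (z ^+ i) -
  \sum_(i < k) z ^+ i * (pmf_nat nu i - pmf_nat (Q n) i)| <= b n.
  apply: le_trans (ler_normB _ _) _; rewrite lerD2l.
  apply: le_trans (ler_norm_sum _ _ _) _; apply: ler_sum => i _.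
  by rewrite normrM ler_piMl// ger0_norm ?exprn_ge0 ?exprn_ile1// ltW.
have -> : e * z ^+ k = e / 2 * z ^+ k + e / 2 * z ^+ k by field.
exact: lerD (le_trans h2 bn) h1.
Qed.

(** No mass escapes: the mass of [Q n] beyond [K] is one minus a finite sum of masses, so it
    converges to that of [nu], which is small for large [K]. *)
Lemma pmf_cvg_Rintegral (Q : nat -> probability nat R) nu f (M : R) :
  (forall k, pmf_nat (Q n) k @[n --> \oo] --> pmf_nat nu k) ->
  (forall k, `|f k| <= M) ->
  \int[Q n]_k f k @[n --> \oo] --> \int[nu]_k f k.
Proof.
move=> H fM.
have M0 : 0 <= M := le_trans (normr_ge0 _) (fM 0%N).
apply/cvgrPdist_le => e e0.
(* The factor 2 counts the tails of [nu] and of [Q n], which agree in the limit. *)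
pose c K := 2 * (M * (1 - \sum_(k < K) pmf_nat nu k)).
have c0 : c K @[K --> \oo] --> 0.
  have : c K @[K --> \oo] --> 2 * (M * (1 - 1)).
    apply: cvgMr; apply: cvgMr; apply: cvgB; first exact: cvg_cst.
    exact: cvg_pmf_nat_sum.
  by rewrite subrr !mulr0.
have e20 : 0 < e / 2 by rewrite divr_gt0.
have /cvgrPdist_le/(_ _ e20)[K _ /(_ K (leqnn K))] := c0.
rewrite sub0r normrN => /(le_trans (ler_norm _)) cK.
pose b n := M * (1 - \sum_(k < K) pmf_nat nu k) +
  M * (1 - \sum_(k < K) pmf_nat (Q n) k) +
  \sum_(k < K) `|f k| * `|pmf_nat nu k - pmf_nat (Q n) k|.
have bc : b n @[n --> \oo] --> c K.
  have -> : c K = M * (1 - \sum_(k < K) pmf_nat nu k) +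
      M * (1 - \sum_(k < K) pmf_nat nu k) +
      \sum_(k < K) `|f k| * `|pmf_nat nu k - pmf_nat nu k|.
    rewrite [X in _ + _ + X]big1 ?addr0 => [|k _].
      by rewrite /c; ring.
    by rewrite subrr normr0 mulr0.
  apply: cvgD; first apply: cvgD; first exact: cvg_cst.
    apply: cvgMr; apply: cvgB; first exact: cvg_cst.
    by apply: cvg_sumr => k _; exact: H.
  apply: cvg_sumr => k _; apply: cvgMr; apply: cvg_norm; apply: cvgB.
    exact: cvg_cst.
  exact: H.
have /cvgrPdist_le/(_ _ e20) := bc; apply: filterS => n bn.
have {}bn : b n <= e.
  have := le_trans (ler_norm _) bn.
  have := bn; rewrite distrC => /(le_trans (ler_norm _)) h _.
  have -> : e = e / 2 + e / 2 by field.
  by move: h cK; set x := e / 2; lra.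
apply: le_trans bn.
pose t Q' := \int[Q']_k f k - \sum_(k < K) f k * pmf_nat Q' k.
have ht Q' : `|t Q'| <= M * (1 - \sum_(k < K) pmf_nat Q' k).
  by apply: (@nat_probability_tail _ _ _ M).
have -> : \int[nu]_k f k - \int[Q n]_k f k = t nu - t (Q n) +
    \sum_(k < K) f k * (pmf_nat nu k - pmf_nat (Q n) k).
  rewrite [X in _ = _ + X](_ : _ = \sum_(k < K) f k * pmf_nat nu k -
      \sum_(k < K) f k * pmf_nat (Q n) k); first by rewrite /t; ring.
  by rewrite -sumrB; apply: eq_bigr => k _; rewrite mulrBr.
apply: le_trans (ler_normD _ _) _; apply: lerD.
  by apply: le_trans (ler_normB _ _) _; apply: lerD.
by apply: le_trans (ler_norm_sum _ _ _) _; apply: ler_sum => k _; rewrite normrM.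
Qed.

Lemma Rintegral_pmf Q f (M l : R) : (forall k, `|f k| <= M) ->
  \sum_(k < K) f k * pmf_nat Q k @[K --> \oo] --> l -> \int[Q]_k f k = l.
Proof.
move=> fM fl; apply/esym/(cvg_unique _ fl) => //.
have M0 : 0 <= M := le_trans (normr_ge0 _) (fM 0%N).
apply/cvgrPdist_le => e e0.
have c0 : M * (1 - \sum_(k < K) pmf_nat Q k) @[K --> \oo] --> 0.
  have : M * (1 - \sum_(k < K) pmf_nat Q k) @[K --> \oo] --> M * (1 - 1).
    apply: cvgMr; apply: cvgB; first exact: cvg_cst.
    exact: cvg_pmf_nat_sum.
  by rewrite subrr mulr0.
have /cvgrPdist_le/(_ _ e0) := c0; apply: filterS => K.
rewrite sub0r normrN => /(le_trans (ler_norm _)); apply: le_trans.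
exact: (@nat_probability_tail _ _ _ M).
Qed.

Lemma expectation_distribution d (T : measurableType d) (P : probability T R)
    (X : {RV P >-> nat}) f (M : R) : (forall k, `|f k| <= M) ->
  'E_P[fun w => f (X w)]%E = (\int[distribution P X]_k f k)%:E.
Proof.
move=> fM; rewrite unlock /Rintegral fineK; last first.
  by apply: integrable_fin_num => //; exact: bounded_integrable_nat fM.
rewrite integral_distribution//; exact: bounded_integrable_rv fM.
Qed.

End nat_probability.

(** * Factorial moments *)

Lemma Rintegral_sum d (T : measurableType d) (R : realType)
    (mu : {measure set T -> \bar R}) (K : nat) (f : nat -> T -> R) :
  (forall i, (i < K)%N -> mu.-integrable setT (EFin \o f i)) ->
  mu.-integrable setT (EFin \o (fun w => \sum_(i < K) f i w)) /\
  \int[mu]_w (\sum_(i < K) f i w) = \sum_(i < K) \int[mu]_w f i w.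
Proof.
elim: K => [|K IH] fi.
  split; last first.
    under eq_Rintegral do rewrite big_ord0.
    by rewrite big_ord0 Rintegral_cst// mul0r.
  by under eq_fun do rewrite /= big_ord0; exact: integrable0.
have [IH1 IH2] := IH (fun i iK => fi i (leqW iK)).
have E w : \sum_(i < K.+1) f i w = \sum_(i < K) f i w + f K w by rewrite big_ord_recr.
split.
  have := integrableD measurableT IH1 (fi K (ltnSn K)).
  by apply: eq_integrable => // w _ /=; rewrite E EFinD.
under eq_Rintegral do rewrite E.
by rewrite RintegralD ?IH2 ?big_ord_recr//; exact: fi.
Qed.

Section factorial_moments.
Context (d : measure_display) (T : measurableType d) (R : realType)
  (P : probability T R) (Z : {RV P >-> nat}).

Lemma factorial_moment0 : factorial_moment Z 0 = 1%E.
Proof.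
by rewrite /factorial_moment; under eq_fun do rewrite ffactn0; rewrite expectation_cst.
Qed.

Lemma factorial_moment_ge0 l : (0 <= factorial_moment Z l)%E.
Proof. by apply: expectation_ge0 => w; exact: ler0n. Qed.

Lemma Rintegral_bin l : factorial_moment Z l \is a fin_num ->
  P.-integrable setT (EFin \o (fun w => 'C(Z w, l)%:R : R)) /\
  \int[P]_w ('C(Z w, l)%:R) = fine (factorial_moment Z l) / l`!%:R.
Proof.
move=> fin.
have lf : l`!%:R != 0 :> R by rewrite pnatr_eq0 -lt0n fact_gt0.
have i1 : P.-integrable setT (EFin \o (fun w => (Z w ^_ l)%:R : R)).
  apply/integrableP; split.
    apply/measurable_EFinP.
    exact: (measurableT_comp (measurable_fun_nat (fun k => (k ^_ l)%:R : R))).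
  under eq_integral do rewrite /= ger0_norm ?ler0n//.
  move: fin; rewrite /factorial_moment unlock ge0_fin_numE//.
  by rewrite integral_ge0// => w _; rewrite lee_fin.
have E w : 'C(Z w, l)%:R = l`!%:R^-1 * (Z w ^_ l)%:R :> R.
  by rewrite -bin_ffact natrM mulrC mulfK.
split.
  have := integrableZl measurableT (l`!%:R^-1) i1.
  by apply: eq_integrable => // w _ /=; rewrite E EFinM.
under eq_Rintegral do rewrite E.
by rewrite RintegralZl// mulrC /factorial_moment unlock.
Qed.

(** Used for two functions: [(1 - w) ^+ x], which gives the generating function of the immigration,
    and the indicator of [j < x], which gives the sign of the weights. *)
Lemma factorial_moment_expansion (g c : nat -> R) (M B : R) (J : nat) :
  (forall l, (l <= J)%N -> factorial_moment Z l \is a fin_num) ->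
  (forall x, `|g x| <= B) ->
  (forall x, `|g x - \sum_(l < J) c l *+ 'C(x, l)| <= M *+ 'C(x, J)) ->
  `|\int[distribution P Z]_k g k -
     \sum_(l < J) c l * (fine (factorial_moment Z l) / l`!%:R)| <=
  M * (fine (factorial_moment Z J) / J`!%:R).
Proof.
move=> fin gB gM.
have EP : \int[distribution P Z]_k g k = \int[P]_w g (Z w).
  apply: EFin_inj; rewrite -(expectation_distribution Z gB) unlock /Rintegral.
  by rewrite fineK// integrable_fin_num//; exact: bounded_integrable_rv gB.
have ig := bounded_integrable_rv Z gB.
have iC l : (l < J)%N -> P.-integrable setT (EFin \o (fun w => c l * 'C(Z w, l)%:R)).
  move=> lJ; have [h _] := Rintegral_bin (fin l (ltnW lJ)).
  have := integrableZl measurableT (c l) h.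
  by apply: eq_integrable => // w _ /=; rewrite EFinM.
have [iS eS] := @Rintegral_sum _ _ _ P J (fun l w => c l * 'C(Z w, l)%:R) iC.
have [iJ eJ] := Rintegral_bin (fin J (leqnn J)).
have -> : \sum_(l < J) c l * (fine (factorial_moment Z l) / l`!%:R) =
    \int[P]_w (\sum_(l < J) c l * 'C(Z w, l)%:R).
  rewrite eS; apply: eq_bigr => l _.
  have [h e] := Rintegral_bin (fin l (ltnW (ltn_ord l))).
  by rewrite RintegralZl// e.
rewrite EP -RintegralB// -eJ -RintegralZl//.
have iB : P.-integrable setT (EFin \o
    (fun w => g (Z w) - \sum_(l < J) c l * 'C(Z w, l)%:R)).
  have := integrableB measurableT ig iS.
  by apply: eq_integrable => // w _ /=; rewrite EFinB.
apply: le_trans (le_normr_Rintegral measurableT iB) _.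
apply: le_Rintegral => //.
- exact: integrable_norm.
- have := integrableZl measurableT M iJ.
  by apply: eq_integrable => // w _ /=; rewrite EFinM.
move=> w _; rewrite mulr_natr; apply: le_trans (gM (Z w)).
rewrite (eq_bigr (fun l : 'I_J => c l *+ 'C(Z w, l)))// => l _.
by rewrite mulr_natr.
Qed.

End factorial_moments.

Lemma cvg_complex_squeeze (R : realType) (u : nat -> R[i]) (l : R[i]) (x : nat -> R) :
  x n @[n --> \oo] --> 0 -> (forall n, `|u n - l| <= ((x n)%:C)%C) ->
  (u n : R[i]^o) @[n --> \oo] --> (l : R[i]^o).
Proof.
move=> x0 ux; apply/cvgrPdist_lt => -[a b].
(* In the order of [R[i]] a positive radius is a positive real. *)
rewrite ltcE /= => /andP[/eqP -> a0].
have /cvgrPdist_lt/(_ _ a0) := x0; apply: filterS => n.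
rewrite sub0r normrN => xa; rewrite distrC; apply: le_lt_trans (ux n) _.
by rewrite ltcR; apply: le_lt_trans (ler_norm _) xa.
Qed.

(** [Q] may have infinite mean. Cutting at a level [K] beyond which the mass is at most [e / 2]
    leaves the Lipschitz constant [K]; the tail is counted twice, in the generating function and in
    the total mass. *)
Lemma pgf_near1 (R : realType) (Q : probability nat R) (e : R) : 0 < e ->
  exists2 A, 0 <= A & forall w, 0 <= w <= 1 ->
    `|\int[Q]_k ((1 - w) ^+ k) - 1| <= e + A * w.
Proof.
move=> e0.
have e20 : 0 < e / 2 by rewrite divr_gt0.
have /cvgrPdist_le/(_ _ e20)[K _ /(_ K (leqnn K))] := cvg_pmf_nat_sum Q.
move=> /(le_trans (ler_norm _)) HK.
exists K%:R => // w /[dup] w01 /andP[w0 w1].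
have wk k : 0 <= (1 - w) ^+ k <= 1.
  by rewrite exprn_ge0 ?subr_ge0// exprn_ile1 ?subr_ge0// gerBl.
have wk1 k : `|(1 - w) ^+ k| <= 1 by have /andP[? ?] := wk k; rewrite ger0_norm.
have h1 := nat_probability_tail Q wk1 (fun k (_ : (K <= k)%N) => wk1 k).
rewrite mul1r in h1.
have -> : \int[Q]_k ((1 - w) ^+ k) - 1 =
    (\int[Q]_k ((1 - w) ^+ k) - \sum_(k < K) (1 - w) ^+ k * pmf_nat Q k) +
    (\sum_(k < K) ((1 - w) ^+ k - 1) * pmf_nat Q k -
     (1 - \sum_(k < K) pmf_nat Q k)).
  rewrite [X in _ = _ + (X - _)](_ : _ = \sum_(k < K) (1 - w) ^+ k * pmf_nat Q k -
    \sum_(k < K) pmf_nat Q k); first by ring.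
  by rewrite -sumrB; apply: eq_bigr => k _; rewrite mulrBl mul1r.
apply: le_trans (ler_normD _ _) _.
have h2 : `|\sum_(k < K) ((1 - w) ^+ k - 1) * pmf_nat Q k| <= K%:R * w.
  apply: le_trans (ler_norm_sum _ _ _) _.
  apply: le_trans (_ : \sum_(k < K) (K%:R * w) * pmf_nat Q k <= _); last first.
    by rewrite -mulr_sumr ler_piMr ?mulr_ge0// pmf_nat_sum_le1.
  apply: ler_sum => k _; rewrite normrM (ger0_norm (pmf_nat_ge0 _ _)).
  rewrite ler_wpM2r ?pmf_nat_ge0//.
  have := binomial_remainder 1 k w01; rewrite big_ord1 expr0 bin0 mulr1n expr1 bin1.
  move/le_trans; apply; rewrite -mulr_natl ler_wpM2r//.
  by rewrite ler_nat ltnW.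
have := ler_normB (\sum_(k < K) ((1 - w) ^+ k - 1) * pmf_nat Q k)
  (1 - \sum_(k < K) pmf_nat Q k).
rewrite [X in _ <= _ + X -> _]ger0_norm ?subr_ge0 ?pmf_nat_sum_le1//.
have : e = e / 2 + e / 2 by field.
by move: HK h1 h2; set x := e / 2; lra.
Qed.

Lemma log_cp_near1 (R : realType) (J : nat) (lambda : nat -> R) :
  exists2 A, 0 <= A & forall w, 0 <= w <= 1 ->
    `|expR (log_cp J lambda w) - 1| <= A * w.
Proof.
pose C := \sum_(1 <= l < J) `|lambda l| * l%:R ^+ 2.
have C0 : 0 <= C by apply: sumr_ge0 => l _; rewrite mulr_ge0// exprn_ge0.
exists (C + C * (C * expR C)).
  by rewrite addr_ge0 ?mulr_ge0 ?expR_ge0.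
move=> w /[dup] w01 /andP[w0 w1].
have := log_cp_bound J lambda w01; rewrite -/C; set t := log_cp J lambda w => tC.
have tC' : `|t| <= C by apply: le_trans tC _; rewrite ler_piMr.
have := expR_taylor1 t; rewrite -real_normK ?num_real// => h.
have : `|expR t - 1| <= `|expR t - 1 - t| + `|t|.
  by rewrite -{1}(subrK t (expR t - 1)); exact: ler_normD.
have : `|t| ^+ 2 * expR `|t| <= C * (C * expR C) * w.
  rewrite expr2 (_ : C * (C * expR C) * w = C * w * C * expR C); last by ring.
  by apply: ler_pM; rewrite ?expR_ge0 ?mulr_ge0 ?ler_expR//; apply: ler_pM.
by rewrite mulrDl; lra.
Qed.

(** * Convergence *)

(** [1 - (1 - rho)] is [1 - r], the scaling factor in [perturbed_contraction_cvg0]. *)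
Lemma INAR1_pgf_recursion d (T : measurableType d) (R : realType)
    (P : probability T R) (xi : nat -> nat -> {RV P >-> nat})
    (eps X : nat -> {RV P >-> nat}) (n : nat) (w : R) :
  inhomogeneous_INAR1 xi eps X -> offspring_mean xi n.+1 < 1 -> 0 <= w <= 1 ->
  \int[distribution P (X n.+1)]_k ((1 - w) ^+ k) =
  \int[distribution P (X n)]_k ((1 - (1 - (1 - offspring_mean xi n.+1)) * w) ^+ k) *
  \int[distribution P (eps n.+1)]_k ((1 - w) ^+ k).
Proof.
move=> HX rho1 /andP[w0 w1].
have rho0 := offspring_mean_ge0 xi n.+1.
set rho := offspring_mean xi n.+1 in rho0 rho1 *.
have bd (z : R) k : 0 <= z <= 1 -> `|z ^+ k| <= 1.
  by move=> /andP[z0 z1]; rewrite ger0_norm ?exprn_ge0// exprn_ile1.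
have z01 : 0 <= 1 - w <= 1 by apply/andP; split; lra.
have z'01 : 0 <= 1 - (1 - (1 - rho)) * w <= 1 by apply/andP; split; nra.
have E (Z : {RV P >-> nat}) (z : R) : 0 <= z <= 1 ->
    (\int[P]_w0 (z ^+ Z w0)%:E)%E = (\int[distribution P Z]_k (z ^+ k))%:E.
  move=> z_01; rewrite -(expectation_distribution Z (fun k => bd z k z_01)).
  by rewrite unlock.
apply: EFin_inj; rewrite EFinM -!E// (INAR1_pgf HX n z01) -/rho.
by congr (_ * _)%E; apply: eq_integral => v _; congr (_ ^+ _)%:E; ring.
Qed.

Lemma pgf_distribution_ge0_le1 (R : realType) (Q : probability nat R) (z : R) :
  0 <= z <= 1 -> 0 <= \int[Q]_k (z ^+ k) <= 1.
Proof.
move=> /andP[z0 z1].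
have bd k : `|z ^+ k| <= 1 by rewrite ger0_norm ?exprn_ge0// exprn_ile1.
apply/andP; split; first by apply: Rintegral_ge0 => k _; exact: exprn_ge0.
have := nat_probability_tail Q bd (fun k (_ : (0 <= k)%N) => bd k).
by rewrite !big_ord0 !subr0 mulr1; apply: le_trans; exact: ler_norm.
Qed.

Section moments_to_weights.
Context d (T : measurableType d) (R : realType) (P : probability T R)
  (eps : nat -> {RV P >-> nat}) (r : nat -> R) (J : nat) (lambda : nat -> R).
Hypothesis J_gt0 : (1 <= J)%N.
Hypothesis r_gt0 : forall n, (1 <= n)%N -> 0 < r n.
Hypothesis cvg_moments : forall j, (1 <= j <= J)%N ->
  (factorial_moment (eps n) j * ((j%:R * r n)^-1)%:E)%E @[n --> \oo]
    --> (lambda j)%:E.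
Hypothesis lambdaJ : lambda J = 0.

Definition scaled_moment (j n : nat) : R :=
  fine (factorial_moment (eps n) j * ((j%:R * r n)^-1)%:E)%E.

Lemma cvg_scaled_moment j : (1 <= j <= J)%N ->
  scaled_moment j n @[n --> \oo] --> lambda j.
Proof. by move=> /cvg_moments/fine_cvgP[]. Qed.

Lemma eventually_moments : exists2 N : nat, (1 <= N)%N &
  forall n, (N <= n)%N -> forall l, (l <= J)%N ->
    factorial_moment (eps n) l \is a fin_num /\
    ((1 <= l)%N -> fine (factorial_moment (eps n) l) = l%:R * r n * scaled_moment l n).
Proof.
have H l : exists N : nat, forall n, (N <= n)%N -> (1 <= l <= J)%N ->
    (factorial_moment (eps n) l * ((l%:R * r n)^-1)%:E)%E \is a fin_num.
  case: (boolP (1 <= l <= J)%N) => lJ; last by exists 0%N.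
  have /fine_cvgP[[N _ HN] _] := cvg_moments lJ.
  by exists N => n Nn _; exact: HN.
(* The range condition sits inside [H], so that a threshold exists for every [l]; the maximum with 1
   below makes [r n] positive. *)
pose Nl l := projT1 (cid (H l)).
exists (maxn 1 (\max_(l < J.+1) Nl l)); first exact: leq_maxl.
move=> n; rewrite geq_max => /andP[n1 Nn] l lJ.
case: l lJ => [|l] lJ; first by rewrite factorial_moment0.
have Nln : (Nl l.+1 <= n)%N.
  by apply: leq_trans Nn; exact: (leq_bigmax (Ordinal (lJ : (l.+1 < J.+1)%N))).
have := projT2 (cid (H l.+1)) n Nln lJ.
have lr : 0 < l.+1%:R * r n by rewrite mulr_gt0// r_gt0.
rewrite /scaled_moment.
have := factorial_moment_ge0 (eps n) l.+1.
case: (factorial_moment (eps n) l.+1) => [m| |]//= _.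
  by move=> _; split=> // _; rewrite [RHS]mulrC divfK// gt_eqF.
(* An infinite moment would make the scaled moment infinite, as [r n] is positive. *)
by rewrite mulyr gtr0_sg ?invr_gt0// mul1e.
Qed.

Lemma immigration_pgf_expansion n w : (1 <= n)%N -> 0 <= w <= 1 ->
  (forall l, (l <= J)%N ->
    factorial_moment (eps n) l \is a fin_num /\
    ((1 <= l)%N -> fine (factorial_moment (eps n) l) = l%:R * r n * scaled_moment l n)) ->
  `|\int[distribution P (eps n)]_k ((1 - w) ^+ k) - 1 -
     \sum_(1 <= l < J) (l%:R * r n * scaled_moment l n) / l`!%:R * (- w) ^+ l| <=
  J%:R * r n * scaled_moment J n / J`!%:R * w ^+ J.
Proof.
move=> n1 /[dup] w01 /andP[w0 w1] Hm.
have bd k : `|(1 - w) ^+ k| <= 1.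
  by rewrite ger0_norm ?exprn_ge0 ?exprn_ile1 ?subr_ge0// gerBl.
have := factorial_moment_expansion (fun l lJ => proj1 (Hm l lJ)) bd
  (fun x => binomial_remainder J x w01).
rewrite (proj2 (Hm J (leqnn J)) J_gt0) [w ^+ J * _]mulrC.
apply: le_trans; rewrite le_eqVlt; apply/orP; left; apply/eqP; congr `|_|.
rewrite -addrA -opprD; congr (_ - _).
rewrite -(big_mkord predT (fun l => (- w) ^+ l * (fine (factorial_moment (eps n) l) / l`!%:R))).
rewrite [RHS]big_ltn// factorial_moment0 expr0 mul1r fact0 divr1; congr (_ + _).
apply: eq_big_nat => l /andP[l1 lJ].
by rewrite (proj2 (Hm l (ltnW lJ)) l1) mulrC.
Qed.

Lemma CP_weight_ge0 j : (1 <= j < J)%N -> 0 <= CP_weight J lambda j.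
Proof.
case: j => // j /andP[_ jJ].
rewrite -(pmulr_rge0 _ (ltr0Sn R j)) -CP_weight_tail.
have [N N1 HN] := eventually_moments.
pose M : R := 1 + \sum_(l < J) `|tail_coef j l| *+ 'C(J, l).
(* For large [n], [b n] dominates [P (eps n > j) / r n]: the Newton part plus its remainder, which
   vanishes in the limit because [lambda J = 0]. *)
pose b n := \sum_(l < J) tail_coef j l * (l%:R * scaled_moment l n) / l`!%:R +
  M * (J%:R * scaled_moment J n / J`!%:R).
have bc : b n @[n --> \oo] -->
    \sum_(l < J) tail_coef j l * (l%:R * lambda l) / l`!%:R + M * (J%:R * lambda J / J`!%:R).
  apply: cvgD; last first.
    apply: cvgMr; apply: cvgMl; apply: cvgMr; apply: cvg_scaled_moment.
    by rewrite J_gt0 leqnn.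
  apply: cvg_sumr => -[[|l] lJ] _ /=.
    by under eq_fun do rewrite !mul0r; rewrite !mul0r; exact: cvg_cst.
  apply: cvgMl; apply: cvgMr; apply: cvgMr; apply: cvg_scaled_moment.
  by rewrite (ltnW lJ).
rewrite lambdaJ mulr0 mul0r mulr0 addr0 in bc.
rewrite -(cvg_lim _ bc)//; apply: limr_ge; first exact: cvgP bc.
exists N => // n /= Nn.
have n1 := leq_trans N1 Nn; have rn := r_gt0 n1.
have Hm := HN n Nn.
pose g x : R := (j < x)%:R.
have g1 x : `|g x| <= 1 by rewrite /g; case: ltnP; rewrite ?normr1 ?normr0.
have := factorial_moment_expansion (fun l lJ => proj1 (Hm l lJ)) g1
  (newton_remainder g1 (fun x xJ => tail_indicatorE R j xJ)).
rewrite -/M (proj2 (Hm J (leqnn J)) J_gt0).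
have : 0 <= \int[distribution P (eps n)]_k g k.
  by apply: Rintegral_ge0 => k _; rewrite /g; case: ltnP.
have -> : \sum_(l < J) tail_coef j l * (fine (factorial_moment (eps n) l) / l`!%:R) =
    r n * \sum_(l < J) tail_coef j l * (l%:R * scaled_moment l n) / l`!%:R.
  rewrite mulr_sumr; apply: eq_bigr => -[[|l] lJ] _ /=; first by rewrite !mul0r mulr0.
  by rewrite (proj2 (Hm l.+1 (ltnW lJ)) isT); ring.
have -> : M * (J%:R * r n * scaled_moment J n / J`!%:R) =
    r n * (M * (J%:R * scaled_moment J n / J`!%:R)) by ring.
move=> I0 /(le_trans (ler_norm _)).
rewrite lerBlDr -mulrDr addrC => /(le_trans I0).
by rewrite pmulr_rge0.
Qed.

End moments_to_weights.

Lemma eseries_pmf1 (R : realType) (p : nat -> R) :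
  \sum_(k < N) p k @[N --> \oo] --> (1 : R) -> (\sum_(k <oo) (p k)%:E = 1)%E.
Proof.
move=> p1; apply/cvg_lim => //.
have : (EFin \o (fun N => \sum_(k < N) p k)) N @[N --> \oo] --> 1%:E.
  by apply: cvg_comp p1 _.
apply: cvg_trans; apply: near_eq_cvg; near=> N.
by rewrite /= big_mkord -sumEFin.
Unshelve. all: by end_near. Qed.

Lemma compound_Poisson_exists (R : realType) (J : nat) (m : nat -> R) :
  (forall j, (1 <= j < J)%N -> 0 <= m j) ->
  exists mu : {finite_measure set nat -> \bar R},
    [/\ mu (~` [set j : nat | (1 <= j <= J.-1)%N]) = 0%E,
        (forall j : nat, (1 <= j <= J.-1)%N -> mu [set j] = (m j)%:E) &
        exists nu : probability nat R, compound_Poisson mu nu /\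
          forall z : R, 0 <= z <= 1 ->
            \int[nu]_k (z ^+ k) = expR (\sum_(1 <= j < J) m j * (z ^+ j - 1))].
Proof.
move=> m0.
pose p j := if (1 <= j < J)%N then m j else 0.
have p0 j : 0 <= p j by rewrite /p; case: ifP => // /m0.
have psum : (\sum_(k <oo) (p k)%:E < +oo)%E.
  rewrite (nneseries_split 0 J) => [|k _]; last by rewrite lee_fin.
  rewrite eseries0 => [|k /=]; last first.
    by rewrite add0n => Jk _; rewrite /p [(k < J)%N]ltnNge Jk andbF.
  by rewrite adde0 sumEFin ltry.
have JE j : (1 <= j <= J.-1)%N = (1 <= j < J)%N by lia.
exists (finite_pmf_measure p0 psum); split.
- apply: esum1 => j /=; rewrite JE => /negP.
  by rewrite /p => /negbTE ->.
- move=> j; rewrite JE => jJ.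
  by apply: etrans (pmf_measure1 p0 j) _; rewrite /p jJ.
have nsum := eseries_pmf1 (cvg_cp_pmf_sum m0).
pose nu : probability nat R := pmf_probability (cp_pmf_ge0 m0) nsum.
have nuE k : nu [set k] = (cp_pmf J m k)%:E by exact: (pmf_measure1 (cp_pmf_ge0 m0) k).
exists nu; split.
  move=> z z1; exists (\sum_(1 <= j < J) ((m j)%:C)%C * (z ^+ j - 1)).
    (* The partial sums of the exponent are constant from [n = J] on. *)
    apply: cvg_near_cst; exists J => // n /= Jn.
    have pE j : fine (finite_pmf_measure p0 psum [set j]) = p j.
      exact: (congr1 fine (pmf_measure1 p0 j)).
    under eq_bigr do rewrite pE.
    case: (posnP J) => [J0|J1].
      rewrite J0 [RHS]big_geq// big1// => j _.
      by rewrite /p J0 ltn0 andbF mul0r.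
    rewrite (big_cat_nat (n := J))//= [X in _ + X]big1_seq ?addr0; last first.
      move=> j /andP[_]; rewrite mem_index_iota => /andP[Jj _].
      by rewrite /p [(j < J)%N]ltnNge Jj andbF mul0r.
    by apply: eq_big_nat => j jJ; rewrite /p jJ.
  have [x x0 Hx] := cp_pmf_pgf m0 z1.
  apply: cvg_complex_squeeze x0 _ => n.
  rewrite (eq_bigr (fun k => ((cp_pmf J m k)%:C)%C * z ^+ k)); first exact: Hx.
  by move=> k _; rewrite nuE.
move=> z /andP[z0 z1].
have bd k : `|z ^+ k| <= 1 by rewrite ger0_norm ?exprn_ge0// exprn_ile1.
apply: (Rintegral_pmf bd).
(* The real generating function is the complex one on the real axis, where [expC] reduces to
   [expR]. *)
have zC : `|(z%:C)%C : R[i]| <= 1 by rewrite normcR ger0_norm// lecR.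
have [x x0 Hx] := cp_pmf_pgf m0 zC.
apply/cvgrPdist_le => e e0.
have /cvgrPdist_le/(_ _ e0) := x0; apply: filterS => n.
rewrite sub0r normrN => /(le_trans (ler_norm _)); apply: le_trans.
rewrite distrC -lecR -normcR; apply: le_trans (Hx n).
rewrite le_eqVlt; apply/orP; left; apply/eqP; congr `|_|.
rewrite rmorphB; congr (_ - _).
  rewrite rmorph_sum big_mkord; apply: eq_bigr => k _.
  by rewrite /pmf_nat nuE rmorphM rmorphXn mulrC.
rewrite (_ : \sum_(1 <= j < J) _ = ((\sum_(1 <= j < J) m j * (z ^+ j - 1))%:C)%C).
  by rewrite /expC /= cos0 sin0; simpc.
rewrite rmorph_sum; apply: eq_bigr => j _.
by rewrite rmorphM rmorphB rmorphXn rmorph1.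
Qed.

Lemma INAR1_pgf_cvg d (T : measurableType d) (R : realType)
    (P : probability T R) (xi : nat -> nat -> {RV P >-> nat})
    (eps X : nat -> {RV P >-> nat}) (J : nat) (lambda : nat -> R) :
  inhomogeneous_INAR1 xi eps X -> (1 <= J)%N ->
  (forall n : nat, (1 <= n)%N -> offspring_mean xi n < 1) ->
  offspring_mean xi n @[n --> \oo] --> (1 : R) ->
  \sum_(1 <= k < n.+1) (1 - offspring_mean xi k) @[n --> \oo] --> +oo ->
  (forall j : nat, (1 <= j <= J)%N ->
    (factorial_moment (eps n) j
       * ((j%:R * (1 - offspring_mean xi n))^-1)%:E)%E @[n --> \oo]
      --> (lambda j)%:E) ->
  lambda J = 0 -> forall w, 0 <= w <= 1 ->
  \int[distribution P (X n)]_k ((1 - w) ^+ k) @[n --> \oo] -->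
    expR (log_cp J lambda w).
Proof.
move=> HX J1 rho1 rho_cvg rdiv Hm lJ0 w w01.
pose r n := 1 - offspring_mean xi n.
have r_gt0 n : (1 <= n)%N -> 0 < r n by move=> /rho1; rewrite subr_gt0.
have r_le1 n : r n <= 1 by rewrite gerBl offspring_mean_ge0.
have r01 n : 0 <= r n.+1 <= 1 by rewrite r_le1 ltW ?r_gt0.
pose b := scaled_moment eps r.
pose G n v := \int[distribution P (X n)]_k ((1 - v) ^+ k).
pose F v := expR (log_cp J lambda v).
have [K K0 HK] := INAR_step_bound J1 lJ0.
pose delta n := K * (\sum_(1 <= l < J.+1) `|b l n - lambda l| + r n).
have r0 : r n @[n --> \oo] --> 0.
  have : r n @[n --> \oo] --> (1 : R) - 1 by apply: cvgB => //; exact: cvg_cst.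
  by rewrite subrr.
have delta0 : delta n @[n --> \oo] --> 0.
  have : delta n @[n --> \oo] -->
      K * (\sum_(1 <= l < J.+1) `|lambda l - lambda l| + 0).
    apply: cvgMr; apply: cvgD => //; apply: cvg_sumr => l.
    rewrite mem_index_iota ltnS => lJ; apply: cvg_norm; apply: cvgB; last exact: cvg_cst.
    exact: (cvg_scaled_moment Hm lJ).
  rewrite addr0 big1 ?mulr0// => l _.
  by rewrite subrr normr0.
have [N N1 HN] := eventually_moments r_gt0 Hm.
suff : `|G n w - F w| @[n --> \oo] --> 0.
  by move=> h; apply/subr_cvg0/norm_cvg0P.
apply: (@perturbed_contraction_cvg0 _ (fun n v => `|G n v - F v|) r delta N) => //.
- move=> n e e0.
  have [A A0 HA] := pgf_near1 (distribution P (X n)) e0.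
  have [A' A'0 HA'] := log_cp_near1 J lambda.
  exists (A + A'); first exact: addr_ge0.
  move=> v v01; rewrite /G /F.
  have -> : \int[distribution P (X n)]_k ((1 - v) ^+ k) - expR (log_cp J lambda v) =
     (\int[distribution P (X n)]_k ((1 - v) ^+ k) - 1) - (expR (log_cp J lambda v) - 1) by ring.
  apply: le_trans (ler_normB _ _) _; rewrite mulrDl addrA.
  by apply: lerD; [exact: HA | exact: HA'].
move=> n v Nn /[dup] v01 /andP[v0 v1].
have Hn := HN n.+1 (leqW Nn).
have Hexp := immigration_pgf_expansion J1 (ltn0Sn n) v01 Hn.
set H := \int[distribution P (eps n.+1)]_k ((1 - v) ^+ k) in Hexp.
have GE : G n.+1 v = G n ((1 - r n.+1) * v) * H.
  exact: INAR1_pgf_recursion HX (rho1 _ (ltn0Sn n)) v01.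
have /andP[H0 H1] : 0 <= H <= 1.
  by apply: pgf_distribution_ge0_le1; apply/andP; split; lra.
(* The first part is the previous distance at the scaled argument, damped by [0 <= H <= 1]; the
   second is the defect of the limit in the recursion, bounded by [INAR_step_bound]. *)
have -> : G n.+1 v - F v =
    (G n ((1 - r n.+1) * v) - F ((1 - r n.+1) * v)) * H +
    (F ((1 - r n.+1) * v) * H - F v) by rewrite GE; ring.
apply: le_trans (ler_normD _ _) _; apply: lerD.
  by rewrite normrM (ger0_norm H0) ler_piMr.
exact: (HK (fun l => b l n.+1) (r n.+1) v H (r01 n) v01 Hexp).
Qed.

Theorem theorem4 (d : measure_display) (T : measurableType d) (R : realType)
    (P : probability T R)
    (xi : nat -> nat -> {RV P >-> nat}) (eps X : nat -> {RV P >-> nat})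
    (J : nat) (lambda : nat -> R) :
  inhomogeneous_INAR1 xi eps X ->
  (1 <= J)%N ->
  (* (i) *)
  (forall n : nat, (1 <= n)%N -> offspring_mean xi n < 1) ->
  offspring_mean xi n @[n --> \oo] --> (1 : R) ->
  \sum_(1 <= k < n.+1) (1 - offspring_mean xi k) @[n --> \oo] --> +oo ->
  (* (ii) *)
  (forall j : nat, (1 <= j <= J)%N ->
    0 <= lambda j /\
    (factorial_moment (eps n) j
       * ((j%:R * (1 - offspring_mean xi n))^-1)%:E)%E @[n --> \oo]
      --> (lambda j)%:E) ->
  lambda J = 0 ->
  exists mu : {finite_measure set nat -> \bar R},
    [/\ mu (~` [set j : nat | (1 <= j <= J.-1)%N]) = 0%E,
        (forall j : nat, (1 <= j <= J.-1)%N ->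
           mu [set j] = (CP_weight J lambda j)%:E) &
        exists nu : probability nat R,
          compound_Poisson mu nu /\ cvg_in_distribution X nu].
Proof.
move=> HX J1 rho1 rho_cvg rdiv Hm lJ0.
have Hm' j (jJ : (1 <= j <= J)%N) := proj2 (Hm j jJ).
have r_gt0 n : (1 <= n)%N -> 0 < 1 - offspring_mean xi n by move=> /rho1; rewrite subr_gt0.
have [mu [mu0 muE [nu [nuCP nupgf]]]] :=
  compound_Poisson_exists (CP_weight_ge0 J1 r_gt0 Hm' lJ0).
exists mu; split=> //; exists nu; split=> // f _ fb.
have [M fM] : exists M, forall k, `|f k| <= M.
  have [M0 [_ HM0]] := fb; exists (M0 + 1) => k; apply: HM0 => //.
  by rewrite ltrDl.
(* Convergence of the generating functions on [[0, 1]] gives the masses, and these give every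
   bounded test function since [nu] has total mass 1. *)
have pmfc : forall k,
    pmf_nat (distribution P (X n)) k @[n --> \oo] --> pmf_nat nu k.
  apply: pgf_cvg_pmf => z z01.
  have w01 : 0 <= 1 - z <= 1 by case/andP: z01 => ? ?; apply/andP; split; lra.
  have := INAR1_pgf_cvg HX J1 rho1 rho_cvg rdiv Hm' lJ0 w01.
  rewrite nupgf// -log_cp_expansion.
  have -> : 1 - (1 - z) = z by ring.
  by rewrite /log_cp; under eq_bigr do rewrite opprB.
have h := pmf_cvg_Rintegral pmfc fM.
have -> : (fun n => 'E_P[fun w => f (X n w)])%E =
    (fun n => (\int[distribution P (X n)]_k f k)%:E).
  by apply/funext => n; exact: expectation_distribution fM.
have -> : (\int[nu]_k (f k)%:E)%E = (\int[nu]_k f k)%:E.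
  by rewrite /Rintegral fineK// integrable_fin_num//; exact: bounded_integrable_nat fM.
exact: cvg_comp h _.
Qed.
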